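(* $$\int_0^\infty \sin^2 (ax)\,\frac{\cosh\beta x}{\sinh x}\,\frac{dx}{x}=\frac14\ln\frac{\cosh 2a\pi+\cos\beta\pi}{1+\cos\beta\pi}.$$
   Formalization: The identity is stated for complex a and β with 2|Im a| + |Re β| < 1 (for real parameters, |β| < 1), with ln the principal logarithm; without a condition the integral can diverge (a = 1, β = 2) or the denominator vanish (β = 1). *)

(* Defs.v *)
From Stdlib Require Export Reals.
From Coquelicot Require Export Coquelicot.

Open Scope R_scope.

Definition Cexp (z : C) : C := (exp (Re z) * cos (Im z), exp (Re z) * sin (Im z)).

Definition Ccos (z : C) : C := ((Cexp (Ci * z) + Cexp (- (Ci * z))) / 2)%C.
Definition Csin (z : C) : C := ((Cexp (Ci * z) - Cexp (- (Ci * z))) / (2 * Ci))%C.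
Definition Ccosh (z : C) : C := ((Cexp z + Cexp (- z)) / 2)%C.
Definition Csinh (z : C) : C := ((Cexp z - Cexp (- z)) / 2)%C.

(* Principal argument, with values in (-PI, PI]; its value at 0 is irrelevant. *)
Definition Carg (z : C) : R :=
  if Rle_dec 0 (Im z) then acos (Re z / Cmod z) else - acos (Re z / Cmod z).

(* Principal branch; it extends the real [ln] on positive reals. *)
Definition Cln (z : C) : C := (ln (Cmod z), Carg z).

(* Main.v *)
Require Import Defs.
From Stdlib Require Import Reals.
From Coquelicot Require Import Coquelicot.
From Stdlib Require Import Ranalysis5 Lra Psatz Lia.
Open Scope R_scope.

(** Put [G(w) = int_0^oo (cosh (w x) - 1) / (x sinh x) dx] for [|Re w| < 1]. The integrand of the
    theorem is half the integrand of [G(beta)] minus a quarter of those of [G(beta + 2ia)] and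
    [G(beta - 2ia)], so everything follows from [exp (G w) * cos (pi w / 2) = 1] and a choice of
    branch.

    Differentiating along [t |-> t w] reduces the former to
    [h(w) := int_0^oo sinh (w x) / sinh x dx = (pi / 2) tan (pi w / 2)]. Expanding [1 / sinh x] in
    powers of [exp (-2x)] gives the partial sums of [sum_k 2w / ((2k+1)^2 - w^2)]. The same partial
    sums appear for the tangent: the integrals [I_N = int_0^(pi/2) cos (w t) cos^N t dt] satisfy
    [(N^2 - w^2) I_N = N (N-1) I_(N-2)], and differentiating this in [w] yields a recurrence for
    [- I_N' / I_N] with the required increments, which tends to 0.

    For the branch, the quotient inside the logarithm is [1 + S^2 / c^2] with [S = sinh (pi a)] and
    [c = cos (pi beta / 2)]. If it were in [(-oo, 0)], then [S = +- i mu c] with [mu >= 1], which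
    contradicts [cosh^2 - sinh^2 = 1] in the region of convergence. Scaling [(a, beta)] by [t] in
    [[0, 1]], the imaginary part of four times the integral is continuous, starts at 0 and never
    hits [+- pi], hence it is the principal argument. *)

(** * Improper integrals on the positive half-line *)

(** Reduces the product filter to explicit thresholds, so that every later limit argument is a plain
    inequality on the two endpoints. *)
Lemma filter_prod_halfline (P : R -> R -> Prop) :
  (exists d B, 0 < d /\ forall a b, 0 < a < d -> B < b -> P a b) ->
  filter_prod (at_right 0) (Rbar_locally p_infty) (fun ab => P (fst ab) (snd ab)).
Proof.
  intros (d & B & Hd & H).
  apply (Filter_prod _ _ _ (fun a => 0 < a < d) (fun b => B < b)).
  - exists (mkposreal d Hd). intros y Hy Hy0. split; auto.
    unfold ball in Hy; simpl in Hy. unfold AbsRing_ball, abs, minus, plus, opp in Hy; simpl in Hy.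
    apply Rabs_def2 in Hy. lra.
  - exists B. auto.
  - intros a b Ha Hb. apply H; auto.
Qed.

Lemma is_RInt_gen_halfline_ext (f g : R -> R) (l : R) :
  (forall x, 0 < x -> f x = g x) ->
  is_RInt_gen f (at_right 0) (Rbar_locally p_infty) l ->
  is_RInt_gen g (at_right 0) (Rbar_locally p_infty) l.
Proof.
  intros H. apply is_RInt_gen_ext.
  apply (filter_prod_halfline (fun a b => forall x, Rmin a b < x < Rmax a b -> f x = g x)).
  exists 1, 1. split; [lra|]. intros a b Ha Hb x Hx. apply H.
  rewrite Rmin_left in Hx by lra. lra.
Qed.

Lemma is_derive_exp_decay (M d x : R) : d <> 0 ->
  is_derive (fun y => - (M / d) * exp (- (d * y))) x (M * exp (- (d * x))).
Proof. intros Hd. auto_derive; [exact I|]. field. exact Hd. Qed.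

Lemma continuous_exp_decay (M d x : R) : continuous (fun y => M * exp (- (d * y))) x.
Proof. apply @ex_derive_continuous. auto_derive. exact I. Qed.

Lemma is_RInt_exp_decay (M d a b : R) : d <> 0 ->
  is_RInt (fun x => M * exp (- (d * x))) a b (M / d * (exp (- (d * a)) - exp (- (d * b)))).
Proof.
  intros Hd.
  replace (M / d * (exp (- (d * a)) - exp (- (d * b))))
    with (minus (- (M / d) * exp (- (d * b))) (- (M / d) * exp (- (d * a))))
    by (unfold minus, plus, opp; simpl; ring).
  apply (is_RInt_derive (fun y => - (M / d) * exp (- (d * y)))).
  - intros x _. apply is_derive_exp_decay. exact Hd.
  - intros x _. apply continuous_exp_decay.
Qed.

Lemma exp_decay_small (d eps : R) : 0 < d -> 0 < eps ->
  exists B, 0 < B /\ forall b, B < b -> exp (- (d * b)) < eps.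
Proof.
  (* Beyond this threshold [d * b > / eps], and [exp y > y] does the rest. *)
  intros Hd He. exists (/ (d * eps)).
  assert (0 < d * eps) by (apply Rmult_lt_0_compat; auto).
  split. { apply Rinv_0_lt_compat; auto. }
  intros b Hb.
  assert (H1 : 1 < d * eps * b).
  { apply Rmult_lt_compat_l with (r := d * eps) in Hb; auto.
    rewrite Rinv_r in Hb; lra. }
  rewrite exp_Ropp.
  assert (Hx : 0 < d * b) by nra.
  pose proof (exp_ineq1 (d * b) ltac:(lra)).
  apply Rmult_lt_reg_l with (exp (d * b)). apply exp_pos.
  rewrite Rinv_r by (apply Rgt_not_eq, exp_pos). nra.
Qed.

Lemma is_RInt_gen_exp_decay (M d : R) : 0 < d ->
  is_RInt_gen (fun x => M * exp (- (d * x))) (at_right 0) (Rbar_locally p_infty) (M / d).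
Proof.
  intros Hd P [eps HP].
  (* The added 1 keeps [K] positive when [M = 0] and strictly above [|M / d|]; each endpoint may
     then contribute an error of [eps / (2 * K)]. *)
  set (K := Rabs (M / d) + 1).
  assert (HK : 0 < K) by (unfold K; pose proof (Rabs_pos (M / d)); lra).
  assert (He : 0 < eps / (2 * K)).
  { apply Rdiv_lt_0_compat. apply cond_pos. lra. }
  destruct (exp_decay_small d (eps / (2 * K)) Hd He) as (B & HB & HBs).
  apply (filter_prod_halfline (fun a b => exists y, is_RInt (fun x => M * exp (- (d * x))) a b y /\ P y)).
  exists (eps / (2 * K) / d), B. split. { apply Rdiv_lt_0_compat; auto. }
  intros a b Ha Hb.
  exists (M / d * (exp (- (d * a)) - exp (- (d * b)))). split.
  { apply is_RInt_exp_decay. lra. }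
  apply HP. unfold ball; simpl. unfold AbsRing_ball, abs, minus, plus, opp; simpl.
  replace (M / d * (exp (- (d * a)) - exp (- (d * b))) + - (M / d))
    with (M / d * ((exp (- (d * a)) - 1) - exp (- (d * b)))) by ring.
  rewrite Rabs_mult.
  specialize (HBs b Hb).
  pose proof (exp_pos (- (d * b))).
  assert (E1 : 1 - d * a <= exp (- (d * a))) by (pose proof (exp_ineq1_le (- (d * a))); lra).
  assert (E2 : exp (- (d * a)) <= 1).
  { rewrite <- exp_0. left. apply exp_increasing. nra. }
  assert (E3 : d * a < eps / (2 * K)).
  { destruct Ha as [_ Ha]. apply Rmult_lt_compat_l with (r := d) in Ha; auto.
    replace (d * (eps / (2 * K) / d)) with (eps / (2 * K)) in Ha by (field; lra). lra. }
  assert (E4 : Rabs (exp (- (d * a)) - 1 - exp (- (d * b))) < 2 * (eps / (2 * K))).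
  { apply Rabs_def1; lra. }
  apply Rle_lt_trans with (Rabs (M / d) * (2 * (eps / (2 * K)))).
  { apply Rmult_le_compat_l. apply Rabs_pos. lra. }
  replace (pos eps) with (K * (2 * (eps / (2 * K)))) at 2 by (field; lra).
  apply Rmult_lt_compat_r; [lra|]. unfold K. lra.
Qed.


Lemma is_RInt_gen_decay_bound (f : R -> R) (M d l : R) : 0 < d ->
  (forall x, 0 < x -> Rabs (f x) <= M * exp (- (d * x))) ->
  is_RInt_gen f (at_right 0) (Rbar_locally p_infty) l -> Rabs l <= M / d.
Proof.
  intros Hd Hf H.
  apply (RInt_gen_norm (V := R_CompleteNormedModule) (Fa := at_right 0)
          (Fb := Rbar_locally p_infty) f (fun x => M * exp (- (d * x)))).
  - apply (filter_prod_halfline (fun a b => a <= b)).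
    exists 1, 1. split; [lra|]. intros; lra.
  - apply (filter_prod_halfline (fun a b => forall x, a <= x <= b -> norm (f x) <= M * exp (- (d * x)))).
    exists 1, 1. split; [lra|]. intros a b Ha Hb x Hx. apply Hf. lra.
  - exact H.
  - apply is_RInt_gen_exp_decay. exact Hd.
Qed.

Lemma ex_RInt_pos (f : R -> R) (a b : R) :
  (forall x, 0 < x -> continuous f x) -> 0 < a -> 0 < b -> ex_RInt f a b.
Proof.
  intros Cf Ha Hb. apply (ex_RInt_continuous (V := R_CompleteNormedModule)).
  intros x Hx. apply Cf.
  assert (0 < Rmin a b) by (apply Rmin_glb_lt; auto). lra.
Qed.

(** The absolute value on the right makes the bound independent of the order of [a] and [b], as the
    Cauchy criterion below requires. *)
Lemma RInt_decay_bound (f : R -> R) (M d a b : R) : 0 < d ->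
  (forall x, 0 < x -> Rabs (f x) <= M * exp (- (d * x))) ->
  (forall x, 0 < x -> continuous f x) -> 0 < a -> 0 < b ->
  Rabs (RInt f a b) <= Rabs (M / d * (exp (- (d * a)) - exp (- (d * b)))).
Proof.
  intros Hd Hf Cf.
  assert (W : forall a b, 0 < a <= b ->
    Rabs (RInt f a b) <= Rabs (M / d * (exp (- (d * a)) - exp (- (d * b))))).
  { clear a b. intros a b Hab.
    eapply Rle_trans; [|apply Rle_abs].
    apply (norm_RInt_le (V := R_NormedModule) f (fun x => M * exp (- (d * x))) a b).
    - lra.
    - intros x Hx. apply Hf. lra.
    - apply (RInt_correct (V := R_CompleteNormedModule)). apply ex_RInt_pos; auto; lra.
    - apply is_RInt_exp_decay. lra. }
  intros Ha Hb. destruct (Rle_dec a b) as [Hab|Hab]; [apply W; lra|].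
  rewrite <- (opp_RInt_swap (V := R_CompleteNormedModule)) by (apply ex_RInt_pos; auto).
  unfold opp; simpl. rewrite Rabs_Ropp.
  replace (exp (- (d * a)) - exp (- (d * b))) with (- (exp (- (d * b)) - exp (- (d * a)))) by ring.
  rewrite Ropp_mult_distr_r_reverse, Rabs_Ropp. apply W. lra.
Qed.

(** Cauchy criterion: passing from [(a, b)] to [(a', b')] changes the integral by one piece near 0
    and one near infinity, each smaller than [eps / 2]. Continuity is asked for positive [x] because
    the kernels divide by [sinh x]. *)
Lemma ex_RInt_gen_decay (f : R -> R) (M d : R) : 0 < d ->
  (forall x, 0 < x -> Rabs (f x) <= M * exp (- (d * x))) ->
  (forall x, 0 < x -> continuous f x) ->
  ex_RInt_gen f (at_right 0) (Rbar_locally p_infty).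
Proof.
  intros Hd Hf Cf.
  assert (HC : exists l : R, filterlim (fun ab => RInt f (fst ab) (snd ab))
     (filter_prod (at_right 0) (Rbar_locally p_infty)) (locally l)).
  { apply (filterlim_locally_cauchy (U := R_CompleteSpace)).
    intros eps.
    set (K := Rabs (M / d) + 1).
    assert (HK : 0 < K) by (unfold K; pose proof (Rabs_pos (M / d)); lra).
    assert (He : 0 < eps / (2 * K)).
    { apply Rdiv_lt_0_compat. apply cond_pos. lra. }
    destruct (exp_decay_small d (eps / (2 * K)) Hd He) as (B & HB & HBs).
    set (e := eps / (2 * K) / d).
    assert (He' : 0 < e) by (apply Rdiv_lt_0_compat; auto).
    exists (fun ab => 0 < fst ab < e /\ B < snd ab). split.
    { apply (filter_prod_halfline (fun a b => 0 < a < e /\ B < b)). exists e, B. tauto. }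
    intros [a b] [a' b']; simpl. intros [Ha Hb] [Ha' Hb'].
    assert (X : forall x y, 0 < x -> 0 < y -> ex_RInt f x y) by (intros; apply ex_RInt_pos; auto).
    assert (0 < a /\ 0 < a' /\ 0 < b /\ 0 < b') as (? & ? & ? & ?) by lra.
    unfold ball; simpl. unfold AbsRing_ball, abs, minus, plus, opp; simpl.
    replace (RInt f a' b' + - RInt f a b) with (RInt f a' a + RInt f b b').
    2:{ assert (E : RInt f a' b' = RInt f a' a + (RInt f a b + RInt f b b')).
        { rewrite <- (RInt_Chasles f a' a b'), <- (RInt_Chasles f a b b');
            auto. }
        rewrite E. ring. }
    assert (S : forall x y, 0 < x -> 0 < y ->
       Rabs (exp (- (d * x)) - exp (- (d * y))) < eps / (2 * K) ->
       Rabs (RInt f x y) < eps / 2).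
    { intros x y Hx Hy Hxy.
      eapply Rle_lt_trans; [apply (RInt_decay_bound f M d); auto|].
      rewrite Rabs_mult.
      replace (eps / 2) with (K * (eps / (2 * K))) by (field; lra).
      apply Rle_lt_trans with (Rabs (M / d) * (eps / (2 * K))).
      { apply Rmult_le_compat_l. apply Rabs_pos. lra. }
      apply Rmult_lt_compat_r; [lra|unfold K; lra]. }
    assert (E3 : forall x, x < e -> d * x < eps / (2 * K)).
    { intros x Hx. apply Rmult_lt_compat_l with (r := d) in Hx; auto.
      replace (d * e) with (eps / (2 * K)) in Hx by (unfold e; field; lra). lra. }
    assert (E1 : forall x, 0 < x < e -> 1 - eps / (2 * K) < exp (- (d * x)) < 1).
    { intros x Hx. pose proof (exp_ineq1_le (- (d * x))). specialize (E3 x (proj2 Hx)).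
      split; [lra|]. rewrite <- exp_0. apply exp_increasing. nra. }
    eapply Rle_lt_trans; [apply Rabs_triang|].
    replace (pos eps) with (eps / 2 + eps / 2) by field.
    apply Rplus_lt_compat; (apply S; [lra|lra|apply Rabs_def1]).
    - pose proof (E1 a Ha). pose proof (E1 a' Ha'). lra.
    - pose proof (E1 a Ha). pose proof (E1 a' Ha'). lra.
    - pose proof (HBs b Hb). pose proof (exp_pos (- (d * b'))). lra.
    - pose proof (HBs b' Hb'). pose proof (exp_pos (- (d * b))). lra. }
  (* [RInt] has a value even where no integral exists, so its limit is an improper integral only
     after restriction to positive endpoints. *)
  destruct HC as [l Hl]. exists l. intros P HP.
  specialize (Hl P HP).
  assert (Hpos : filter_prod (at_right 0) (Rbar_locally p_infty) (fun ab => 0 < fst ab /\ 0 < snd ab)).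
  { apply (filter_prod_halfline (fun a b => 0 < a /\ 0 < b)). exists 1, 0.
    split; [lra|]. intros; lra. }
  unfold filtermap in Hl. unfold filtermapi.
  generalize (filter_and _ _ Hl Hpos). apply filter_imp.
  intros [a b]; simpl. intros [H1 [H2 H3]].
  exists (RInt f a b). split; auto.
  apply (RInt_correct (V := R_CompleteNormedModule)). apply ex_RInt_pos; auto.
Qed.

(** * Complex-valued functions of a real variable *)

(** The primitive tends to 0 at infinity by the exponential bound and is continuous at 0, so only
    [F 0] survives. *)
Lemma is_RInt_gen_halfline_FTC (F f : R -> R) (M d : R) : 0 < d ->
  (forall x, is_derive F x (f x)) -> (forall x, continuous f x) ->
  (forall x, 0 < x -> Rabs (F x) <= M * exp (- (d * x))) ->
  is_RInt_gen f (at_right 0) (Rbar_locally p_infty) (- F 0).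
Proof.
  intros Hd HF Cf HM.
  assert (HD : forall x, Derive F x = f x) by (intros; apply is_derive_unique, HF).
  apply is_RInt_gen_halfline_ext with (Derive F); [intros; apply HD|].
  replace (- F 0) with (0 - F 0) by ring.
  apply is_RInt_gen_Derive.
  - apply (filter_prod_halfline (fun a b => forall x, Rmin a b <= x <= Rmax a b -> ex_derive F x)).
    exists 1, 1. split; [lra|]. intros. eexists; apply HF.
  - apply (filter_prod_halfline (fun a b => forall x, Rmin a b <= x <= Rmax a b -> continuous (Derive F) x)).
    exists 1, 1. split; [lra|]. intros.
    apply continuous_ext with f; [intros; symmetry; apply HD|apply Cf].
  - eapply filterlim_filter_le_1; [apply filter_le_within|].
    apply (ex_derive_continuous (V := R_NormedModule)). eexists; apply HF.
  - intros P [eps HP].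
    (* The bound at [x = 1] forces the sign of [M], which makes [M + 1] a positive divisor. *)
    assert (M0 : 0 <= M).
    { pose proof (HM 1 Rlt_0_1). pose proof (Rabs_pos (F 1)). pose proof (exp_pos (- (d * 1))). nra. }
    assert (He : 0 < eps / (M + 1)) by (apply Rdiv_lt_0_compat; [apply cond_pos|lra]).
    destruct (exp_decay_small d (eps / (M + 1)) Hd He) as (B & HB & HBs).
    exists B. intros b Hb. apply HP.
    unfold ball; simpl. unfold AbsRing_ball, abs, minus, plus, opp; simpl.
    rewrite Ropp_0, Rplus_0_r. eapply Rle_lt_trans; [apply HM; lra|].
    specialize (HBs b Hb).
    replace (pos eps) with ((M + 1) * (eps / (M + 1))) by (field; lra).
    pose proof (exp_pos (- (d * b))). nra.
Qed.

(* Complex derivatives and integrals are taken componentwise, [CInt] over (0, +oo). *)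
Definition Cder (f : R -> C) (x : R) (l : C) : Prop :=
  is_derive (fun t => Re (f t)) x (Re l) /\ is_derive (fun t => Im (f t)) x (Im l).

Definition CInt (f : R -> C) (l : C) : Prop :=
  is_RInt_gen (fun t => Re (f t)) (at_right 0) (Rbar_locally p_infty) (Re l) /\
  is_RInt_gen (fun t => Im (f t)) (at_right 0) (Rbar_locally p_infty) (Im l).

Definition CIntv (f : R -> C) : C :=
  (RInt_gen (fun t => Re (f t)) (at_right 0) (Rbar_locally p_infty),
   RInt_gen (fun t => Im (f t)) (at_right 0) (Rbar_locally p_infty)).

Definition CRInt (f : R -> C) (a b : R) (l : C) : Prop :=
  is_RInt (fun t => Re (f t)) a b (Re l) /\ is_RInt (fun t => Im (f t)) a b (Im l).

Lemma C_ext (z w : C) : Re z = Re w -> Im z = Im w -> z = w.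
Proof. destruct z, w; simpl; intros; subst; reflexivity. Qed.

Lemma is_derive_eq (f : R -> R) (x l l' : R) : is_derive f x l -> l = l' -> is_derive f x l'.
Proof. intros H <-. exact H. Qed.

Lemma Cder_eq (f : R -> C) (x : R) (l l' : C) : Cder f x l -> l = l' -> Cder f x l'.
Proof. intros H <-. exact H. Qed.

Lemma Cder_ext (f g : R -> C) (x : R) (l : C) :
  (forall t, f t = g t) -> Cder f x l -> Cder g x l.
Proof.
  intros H [H1 H2]; split; (eapply is_derive_ext; [|eassumption]);
    intros t; simpl; rewrite H; reflexivity.
Qed.

Lemma Cder_const (c : C) (x : R) : Cder (fun _ => c) x 0.
Proof. split; apply @is_derive_const. Qed.

Lemma Cder_RtoC (f : R -> R) (x l : R) : is_derive f x l -> Cder (fun t => RtoC (f t)) x (RtoC l).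
Proof. intros H; split; simpl. exact H. apply @is_derive_const. Qed.

Lemma Cder_plus (f g : R -> C) (x : R) (l m : C) :
  Cder f x l -> Cder g x m -> Cder (fun t => f t + g t)%C x (l + m)%C.
Proof. intros [H1 H2] [H3 H4]; split; simpl; apply @is_derive_plus; assumption. Qed.

Lemma Cder_opp (f : R -> C) (x : R) (l : C) :
  Cder f x l -> Cder (fun t => - f t)%C x (- l)%C.
Proof. intros [H1 H2]; split; simpl; apply @is_derive_opp; assumption. Qed.

Lemma Cder_minus (f g : R -> C) (x : R) (l m : C) :
  Cder f x l -> Cder g x m -> Cder (fun t => f t - g t)%C x (l - m)%C.
Proof. intros H1 H2. apply Cder_plus; [|apply Cder_opp]; assumption. Qed.

Lemma Cder_mult (f g : R -> C) (x : R) (l m : C) :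
  Cder f x l -> Cder g x m -> Cder (fun t => f t * g t)%C x (l * g x + f x * m)%C.
Proof.
  intros [H1 H2] [H3 H4].
  pose proof Rmult_comm as mc.
  split; simpl.
  - eapply is_derive_eq.
    + apply (@is_derive_minus R_AbsRing R_NormedModule);
        apply (@is_derive_mult R_AbsRing); eauto.
    + unfold minus, plus, opp, mult; simpl. unfold Re, Im. ring.
  - eapply is_derive_eq.
    + apply (@is_derive_plus R_AbsRing R_NormedModule);
        apply (@is_derive_mult R_AbsRing); eauto.
    + unfold minus, plus, opp, mult; simpl. unfold Re, Im. ring.
Qed.

Lemma Cder_Cexp (f : R -> C) (x : R) (l : C) :
  Cder f x l -> Cder (fun t => Cexp (f t)) x (l * Cexp (f x))%C.
Proof.
  intros [H1 H2]. pose proof Rmult_comm as mc.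
  assert (E : is_derive (fun t => exp (Re (f t))) x (Re l * exp (Re (f x)))).
  { apply (is_derive_comp exp (fun t => Re (f t))); auto. apply is_derive_exp. }
  assert (Cc : is_derive (fun t => cos (Im (f t))) x (Im l * - sin (Im (f x)))).
  { apply (is_derive_comp cos (fun t => Im (f t))); auto. apply is_derive_cos. }
  assert (S : is_derive (fun t => sin (Im (f t))) x (Im l * cos (Im (f x)))).
  { apply (is_derive_comp sin (fun t => Im (f t))); auto. apply is_derive_sin. }
  split; simpl.
  - eapply is_derive_eq; [apply (@is_derive_mult R_AbsRing); eauto|].
    unfold minus, plus, opp, mult; simpl. unfold Re, Im. ring.
  - eapply is_derive_eq; [apply (@is_derive_mult R_AbsRing); eauto|].
    unfold minus, plus, opp, mult; simpl. unfold Re, Im. ring.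
Qed.

Lemma Cder_scal_id (c : C) (x : R) : Cder (fun t => RtoC t * c)%C x c.
Proof.
  eapply Cder_eq.
  - apply Cder_mult; [apply (Cder_RtoC (fun t => t) x 1), @is_derive_id|apply Cder_const].
  - cbv beta. ring.
Qed.

Lemma Cder_continuous (f : R -> C) (x : R) (l : C) : Cder f x l ->
  continuous (fun t => Re (f t)) x /\ continuous (fun t => Im (f t)) x.
Proof.
  intros [H1 H2].
  split; apply (ex_derive_continuous (V := R_NormedModule)); eexists; eassumption.
Qed.

Lemma Cder_zero_eq (f : R -> C) (a b : R) : a < b ->
  (forall t, a <= t <= b -> Cder f t 0) -> f a = f b.
Proof.
  intros Hab H.
  assert (W : forall g : R -> R, (forall t, a <= t <= b -> is_derive g t 0) -> g a = g b).
  { intros g Hg. apply (eq_is_derive (V := R_NormedModule) g a b); auto. }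
  apply C_ext; [apply (W (fun t => Re (f t)))|apply (W (fun t => Im (f t)))];
    intros t Ht; apply (H t Ht).
Qed.

(** * The complex exponential and its modulus *)

Lemma Cexp_plus (z w : C) : Cexp (z + w) = (Cexp z * Cexp w)%C.
Proof.
  unfold Cexp. apply C_ext; simpl; rewrite exp_plus, ?cos_plus, ?sin_plus; unfold Re, Im; ring.
Qed.

Lemma Cexp_0 : Cexp 0 = 1.
Proof. unfold Cexp; simpl. rewrite exp_0, cos_0, sin_0. apply C_ext; simpl; ring. Qed.

Lemma Cexp_opp (z : C) : (Cexp z * Cexp (- z) = 1)%C.
Proof. rewrite <- Cexp_plus, <- Cexp_0. f_equal. ring. Qed.

Lemma Cmod_Cexp (z : C) : Cmod (Cexp z) = exp (Re z).
Proof.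
  unfold Cmod, Cexp; simpl.
  replace (_ + _) with (exp (Re z) * exp (Re z)).
  - rewrite sqrt_square; [reflexivity|left; apply exp_pos].
  - pose proof (sin2_cos2 (Im z)) as H. unfold Rsqr in H.
    transitivity (exp (Re z) * exp (Re z) * (sin (Im z) * sin (Im z) + cos (Im z) * cos (Im z)));
      [rewrite H; ring|unfold Re, Im; ring].
Qed.

Lemma Im_le_Cmod (z : C) : Rabs (Im z) <= Cmod z.
Proof. eapply Rle_trans; [apply Rmax_r|apply Rmax_Cmod]. Qed.

Lemma Cmod_le_Re_Im (z : C) : Cmod z <= Rabs (Re z) + Rabs (Im z).
Proof.
  rewrite <- (Cmod_R (Re z)), <- (Cmod_R (Im z)).
  replace (Cmod (RtoC (Im z))) with (Cmod (RtoC (Im z) * Ci)).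
  - eapply Rle_trans; [|apply Cmod_triangle]. right. f_equal. apply C_ext; simpl; ring.
  - rewrite Cmod_mult. replace (Cmod Ci) with 1; [ring|].
    unfold Cmod; simpl. replace (_ + _) with 1 by ring. rewrite sqrt_1. reflexivity.
Qed.

(** * Complex improper integrals *)

Lemma CInt_ext (f g : R -> C) (l : C) :
  (forall x, 0 < x -> f x = g x) -> CInt f l -> CInt g l.
Proof.
  intros H [H1 H2]; split; (eapply is_RInt_gen_halfline_ext; [|eassumption]);
    intros t Ht; simpl; rewrite H; auto.
Qed.

Lemma CInt_plus (f g : R -> C) (l m : C) :
  CInt f l -> CInt g m -> CInt (fun x => f x + g x)%C (l + m)%C.
Proof. intros [H1 H2] [H3 H4]; split; simpl; apply @is_RInt_gen_plus; try assumption; apply _. Qed.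

Lemma CInt_scal (c : C) (f : R -> C) (l : C) :
  CInt f l -> CInt (fun x => c * f x)%C (c * l)%C.
Proof.
  intros [H1 H2].
  split; simpl; [apply (@is_RInt_gen_minus R_NormedModule)|apply (@is_RInt_gen_plus R_NormedModule)];
    try apply _; apply (@is_RInt_gen_scal R_NormedModule); try apply _; assumption.
Qed.

Lemma CInt_minus (f g : R -> C) (l m : C) :
  CInt f l -> CInt g m -> CInt (fun x => f x - g x)%C (l - m)%C.
Proof.
  intros H1 H2.
  replace (l - m)%C with (l + (-1) * m)%C by ring.
  eapply CInt_ext; [|apply CInt_plus; [exact H1|apply CInt_scal; exact H2]].
  intros; simpl. ring.
Qed.

Lemma CInt_unique (f : R -> C) (l m : C) : CInt f l -> CInt f m -> l = m.
Proof.
  intros [H1 H2] [H3 H4].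
  apply C_ext.
  - rewrite <- (is_RInt_gen_unique (V := R_CompleteNormedModule) _ _ H1).
    apply (is_RInt_gen_unique (V := R_CompleteNormedModule) _ _ H3).
  - rewrite <- (is_RInt_gen_unique (V := R_CompleteNormedModule) _ _ H2).
    apply (is_RInt_gen_unique (V := R_CompleteNormedModule) _ _ H4).
Qed.

(** The factor 2 comes from estimating the real and the imaginary part separately. *)
Lemma CInt_bound (f : R -> C) (M d : R) (l : C) : 0 < d ->
  (forall x, 0 < x -> Cmod (f x) <= M * exp (- (d * x))) ->
  CInt f l -> Cmod l <= 2 * (M / d).
Proof.
  intros Hd Hf [H1 H2].
  eapply Rle_trans; [apply Cmod_le_Re_Im|].
  apply is_RInt_gen_decay_bound with (M := M) (d := d) in H1; auto.
  - apply is_RInt_gen_decay_bound with (M := M) (d := d) in H2; auto; [lra|].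
    intros x Hx. eapply Rle_trans; [apply Im_le_Cmod|auto].
  - intros x Hx. eapply Rle_trans; [apply re_le_Cmod|auto].
Qed.

Lemma CInt_CIntv (f : R -> C) (M d : R) : 0 < d ->
  (forall x, 0 < x -> Cmod (f x) <= M * exp (- (d * x))) ->
  (forall x, 0 < x -> exists l, Cder f x l) ->
  CInt f (CIntv f).
Proof.
  intros Hd Hf Df.
  split; simpl; apply (RInt_gen_correct (V := R_CompleteNormedModule));
    apply ex_RInt_gen_decay with M d; auto.
  - intros x Hx. eapply Rle_trans; [apply re_le_Cmod|auto].
  - intros x Hx. destruct (Df x Hx) as [l Hl]. apply (Cder_continuous _ _ _ Hl).
  - intros x Hx. eapply Rle_trans; [apply Im_le_Cmod|auto].
  - intros x Hx. destruct (Df x Hx) as [l Hl]. apply (Cder_continuous _ _ _ Hl).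
Qed.

(** Passage from componentwise integrals to the integral of the theorem: balls in [C_R_NormedModule]
    are boxes, so it suffices to intersect the two eventual statements. *)
Lemma CInt_is_RInt_gen (f : R -> C) (l : C) : CInt f l ->
  is_RInt_gen (V := C_R_NormedModule) f (at_right 0) (Rbar_locally p_infty) l.
Proof.
  intros [H1 H2] P [eps HP].
  assert (He : 0 < eps) by apply cond_pos.
  specialize (H1 (fun y => ball (Re l) eps y) (locally_ball _ _)).
  specialize (H2 (fun y => ball (Im l) eps y) (locally_ball _ _)).
  unfold filtermapi in *.
  generalize (filter_and _ _ H1 H2). apply filter_imp.
  intros [a b]; simpl. intros [(y & Iy & By) (z & Iz & Bz)].
  exists (y, z). split.
  - apply (is_RInt_fct_extend_pair (U := R_NormedModule) (V := R_NormedModule) f a b y z Iy Iz).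
  - apply HP. split; assumption.
Qed.

(** The primitive [- exp (- x p) / p] has modulus [exp (- x Re p) / |p|], which provides the decay
    at infinity. *)
Lemma CInt_exp (p : C) : 0 < Re p -> CInt (fun x => Cexp (- (RtoC x * p)))%C (/ p)%C.
Proof.
  intros Hp.
  assert (p0 : p <> 0) by (intros ->; simpl in Hp; lra).
  set (F := fun x => (- / p * Cexp (- (RtoC x * p)))%C).
  assert (D : forall x, Cder F x (Cexp (- (RtoC x * p)))%C).
  { intros x. eapply Cder_eq.
    - apply Cder_mult; [apply Cder_const|apply Cder_Cexp, Cder_opp, Cder_scal_id].
    - simpl. field. exact p0. }
  assert (E : (/ p = - F 0)%C).
  { unfold F. rewrite Cmult_0_l. replace (- 0)%C with (RtoC 0) by ring. rewrite Cexp_0. ring. }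
  assert (B : forall x, Cmod (F x) = Cmod (/ p) * exp (- (Re p * x))).
  { intros x. unfold F. rewrite Cmod_mult, Cmod_opp, Cmod_Cexp. do 2 f_equal.
    unfold Cmult, Copp, RtoC, Re; simpl. ring. }
  assert (Cf : forall x, continuous (fun t => Re (Cexp (- (RtoC t * p)))%C) x /\
                         continuous (fun t => Im (Cexp (- (RtoC t * p)))%C) x).
  { intros x. eapply Cder_continuous. apply Cder_Cexp, Cder_opp, Cder_scal_id. }
  rewrite E. split.
  - apply (is_RInt_gen_halfline_FTC (fun x => Re (F x)) _ (Cmod (/ p)) (Re p)); auto.
    + intros x. apply D.
    + intros x. exact (proj1 (Cf x)).
    + intros x _. rewrite <- B. apply re_le_Cmod.
  - apply (is_RInt_gen_halfline_FTC (fun x => Im (F x)) _ (Cmod (/ p)) (Re p)); auto.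
    + intros x. apply D.
    + intros x. exact (proj2 (Cf x)).
    + intros x _. rewrite <- B. apply Im_le_Cmod.
Qed.

(** * Complex integrals over compact intervals *)

Lemma CRInt_FTC (F f : R -> C) (a b : R) :
  (forall x, Cder F x (f x)) -> (forall x, exists l, Cder f x l) ->
  CRInt f a b (F b - F a)%C.
Proof.
  intros HF Hf. split.
  - apply (is_RInt_derive (V := R_CompleteNormedModule) (fun x => Re (F x))).
    + intros x _. apply HF.
    + intros x _. destruct (Hf x) as [l Hl]. apply (Cder_continuous _ _ _ Hl).
  - apply (is_RInt_derive (V := R_CompleteNormedModule) (fun x => Im (F x))).
    + intros x _. apply HF.
    + intros x _. destruct (Hf x) as [l Hl]. apply (Cder_continuous _ _ _ Hl).
Qed.

Definition CRIntv (f : R -> C) (a b : R) : C :=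
  (RInt (fun t => Re (f t)) a b, RInt (fun t => Im (f t)) a b).

Lemma CRInt_CRIntv (f : R -> C) (a b : R) :
  (forall x, exists l, Cder f x l) -> CRInt f a b (CRIntv f a b).
Proof.
  intros Hf.
  split; simpl; apply (RInt_correct (V := R_CompleteNormedModule));
    apply (ex_RInt_continuous (V := R_CompleteNormedModule)); intros x _;
    destruct (Hf x) as [l Hl]; apply (Cder_continuous _ _ _ Hl).
Qed.

Lemma CRInt_ext (f g : R -> C) (a b : R) (l : C) :
  (forall x, f x = g x) -> CRInt f a b l -> CRInt g a b l.
Proof.
  intros H [H1 H2]; split; (eapply is_RInt_ext; [|eassumption]);
    intros t Ht; simpl; rewrite H; auto.
Qed.

Lemma CRInt_plus (f g : R -> C) (a b : R) (l m : C) :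
  CRInt f a b l -> CRInt g a b m -> CRInt (fun x => f x + g x)%C a b (l + m)%C.
Proof. intros [H1 H2] [H3 H4]; split; simpl; apply @is_RInt_plus; assumption. Qed.

Lemma CRInt_scal (c : C) (f : R -> C) (a b : R) (l : C) :
  CRInt f a b l -> CRInt (fun x => c * f x)%C a b (c * l)%C.
Proof.
  intros [H1 H2].
  split; simpl; [apply (@is_RInt_minus R_NormedModule)|apply (@is_RInt_plus R_NormedModule)];
    apply (@is_RInt_scal R_NormedModule); assumption.
Qed.

Lemma CRInt_unique (f : R -> C) (a b : R) (l m : C) : CRInt f a b l -> CRInt f a b m -> l = m.
Proof.
  intros [H1 H2] [H3 H4].
  apply C_ext.
  - rewrite <- (is_RInt_unique (V := R_CompleteNormedModule) _ _ _ _ H1).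
    apply (is_RInt_unique (V := R_CompleteNormedModule) _ _ _ _ H3).
  - rewrite <- (is_RInt_unique (V := R_CompleteNormedModule) _ _ _ _ H2).
    apply (is_RInt_unique (V := R_CompleteNormedModule) _ _ _ _ H4).
Qed.

Lemma CRInt_bound (f : R -> C) (g : R -> R) (a b : R) (l : C) (m : R) : a <= b ->
  (forall x, a <= x <= b -> Cmod (f x) <= g x) ->
  CRInt f a b l -> is_RInt g a b m -> Cmod l <= 2 * m.
Proof.
  intros Hab Hf [H1 H2] Hg.
  eapply Rle_trans; [apply Cmod_le_Re_Im|].
  apply (norm_RInt_le (V := R_NormedModule) _ g a b _ m) in H1; auto.
  - apply (norm_RInt_le (V := R_NormedModule) _ g a b _ m) in H2; auto.
    + unfold norm in H1, H2; simpl in H1, H2. unfold abs in H1, H2; simpl in H1, H2. lra.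
    + intros x Hx. eapply Rle_trans; [apply Im_le_Cmod|auto].
  - intros x Hx. eapply Rle_trans; [apply re_le_Cmod|auto].
Qed.

Lemma CRInt_bound_const (f : R -> C) (M : R) (l : C) :
  (forall x, 0 <= x <= 1 -> Cmod (f x) <= M) -> CRInt f 0 1 l -> Cmod l <= 2 * M.
Proof.
  intros H Hl. apply (CRInt_bound f (fun _ => M) 0 1 l M); auto; [lra|].
  pose proof (is_RInt_const (V := R_NormedModule) 0 1 M) as K.
  assert (E : @scal R_AbsRing R_NormedModule (1 - 0) M = M)
    by (unfold scal; simpl; unfold mult; simpl; ring).
  exact (eq_ind _ (is_RInt (V := R_NormedModule) (fun _ => M) 0 1) K _ E).
Qed.

(** * Taylor remainders of the exponential and hyperbolic functions *)

Lemma exp_le (x y : R) : x <= y -> exp x <= exp y.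
Proof. intros [H|<-]; [left; apply exp_increasing; auto|lra]. Qed.

Lemma Re_RtoC_mult (r : R) (z : C) : Re (RtoC r * z) = r * Re z.
Proof. simpl. unfold Re. ring. Qed.

Lemma Rabs_Re_segment (r : R) (z : C) : 0 <= r <= 1 -> Re (RtoC r * z) <= Rabs (Re z).
Proof.
  intros Hr. rewrite Re_RtoC_mult. pose proof (Rle_abs (Re z)). pose proof (Rabs_pos (Re z)). nra.
Qed.

(** [exp z - 1] is the integral of [z exp (t z)] over [[0, 1]]. The growth is measured by [Re z]
    alone, because [1 / sinh x] must later beat it in the whole strip [|Re w| < 1]. *)
Lemma Cmod_Cexp_sub_1 (z : C) : Cmod (Cexp z - 1) <= 2 * (Cmod z * exp (Rabs (Re z))).
Proof.
  assert (D : forall t, Cder (fun t => Cexp (RtoC t * z)) t (z * Cexp (RtoC t * z))%C).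
  { intros t. apply Cder_Cexp, Cder_scal_id. }
  pose proof (CRInt_FTC _ _ 0 1 D) as H. cbv beta in H.
  rewrite Cmult_1_l, Cmult_0_l, Cexp_0 in H.
  eapply CRInt_bound_const; [|apply H].
  - intros x Hx. cbv beta. rewrite Cmod_mult, Cmod_Cexp.
    apply Rmult_le_compat_l; [apply Cmod_ge_0|]. apply exp_le, Rabs_Re_segment. exact Hx.
  - intros x. eexists. apply Cder_mult; [apply Cder_const|apply D].
Qed.

(** The first-order bound is integrated once more along the segment from 0 to [z], which doubles the
    constant again. *)
Lemma Cmod_Cexp_sub_1_sub (z : C) :
  Cmod (Cexp z - 1 - z) <= 4 * (Cmod z * Cmod z * exp (Rabs (Re z))).
Proof.
  assert (D : forall t, Cder (fun t => Cexp (RtoC t * z) - RtoC t * z)%C t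
      (z * Cexp (RtoC t * z) - z)%C).
  { intros t. apply Cder_minus; [apply Cder_Cexp|]; apply Cder_scal_id. }
  pose proof (CRInt_FTC _ _ 0 1 D) as H. cbv beta in H.
  rewrite Cmult_1_l, Cmult_0_l, Cexp_0 in H.
  replace (Cexp z - 1 - z)%C with (Cexp z - z - (1 - 0))%C by ring.
  replace (4 * (Cmod z * Cmod z * exp (Rabs (Re z))))
    with (2 * (Cmod z * (2 * (Cmod z * exp (Rabs (Re z)))))) by ring.
  eapply CRInt_bound_const; [|apply H].
  - intros x Hx. cbv beta.
    replace (z * Cexp (RtoC x * z) - z)%C with (z * (Cexp (RtoC x * z) - 1))%C by ring.
    rewrite Cmod_mult. apply Rmult_le_compat_l; [apply Cmod_ge_0|].
    eapply Rle_trans; [apply Cmod_Cexp_sub_1|].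
    apply Rmult_le_compat_l; [lra|]. rewrite Cmod_mult, Cmod_R, Re_RtoC_mult, Rabs_mult.
    rewrite (Rabs_pos_eq x) by lra.
    pose proof (Cmod_ge_0 z). pose proof (Rabs_pos (Re z)).
    apply Rmult_le_compat; try nra. { left; apply exp_pos. } apply exp_le. nra.
  - intros x. eexists. apply Cder_minus; [|apply Cder_const].
    apply Cder_mult; [apply Cder_const|apply Cder_Cexp, Cder_scal_id].
Qed.

Lemma Cmod_half (z : C) : Cmod (z / 2) = Cmod z / 2.
Proof.
  unfold Cdiv. rewrite <- RtoC_inv by lra. rewrite Cmod_mult, Cmod_R.
  rewrite Rabs_pos_eq; lra.
Qed.

(** Splitting into exponentials pulls out [exp z] and [exp (- z)] and leaves the second-order
    remainders of [exp] at [e] and [- e]. This is the pointwise estimate behind differentiation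
    under the integral sign. *)
Lemma Ccosh_increment (z e : C) :
  Cmod (Ccosh (z + e) - Ccosh z - e * Csinh z)
    <= 4 * (Cmod e * Cmod e * exp (Rabs (Re z) + Rabs (Re e))).
Proof.
  replace (Ccosh (z + e) - Ccosh z - e * Csinh z)%C
    with ((Cexp z * (Cexp e - 1 - e) + Cexp (- z) * (Cexp (- e) - 1 - - e)) / 2)%C.
  2:{ unfold Ccosh, Csinh. replace (- (z + e))%C with (- z + - e)%C by ring.
      rewrite !Cexp_plus. field. }
  rewrite Cmod_half.
  pose proof (Cmod_Cexp_sub_1_sub e) as H1.
  pose proof (Cmod_Cexp_sub_1_sub (- e)) as H2.
  rewrite Cmod_opp in H2. replace (Rabs (Re (- e)%C)) with (Rabs (Re e)) in H2
    by (simpl; rewrite Rabs_Ropp; reflexivity).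
  set (K := 4 * (Cmod e * Cmod e * exp (Rabs (Re e)))) in *.
  assert (E1 : exp (Re z) <= exp (Rabs (Re z))) by apply exp_le, Rle_abs.
  assert (E2 : exp (- Re z) <= exp (Rabs (Re z))).
  { apply exp_le. rewrite <- Rabs_Ropp. apply Rle_abs. }
  assert (T : Cmod (Cexp z * (Cexp e - 1 - e) + Cexp (- z) * (Cexp (- e) - 1 - - e))
    <= exp (Rabs (Re z)) * K + exp (Rabs (Re z)) * K).
  { eapply Rle_trans; [apply Cmod_triangle|]. rewrite !Cmod_mult, !Cmod_Cexp.
    apply Rplus_le_compat; apply Rmult_le_compat; auto using Cmod_ge_0;
      left; apply exp_pos. }
  rewrite exp_plus. unfold K in T. lra.
Qed.

Lemma Ccosh_0 : Ccosh 0 = 1.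
Proof.
  unfold Ccosh. replace (- 0)%C with (RtoC 0) by ring. rewrite Cexp_0. field.
Qed.

Lemma Csinh_0 : Csinh 0 = 0.
Proof.
  unfold Csinh. replace (- 0)%C with (RtoC 0) by ring. rewrite Cexp_0. field.
Qed.

Lemma Cmod_Ccosh_sub_1 (z : C) : Cmod (Ccosh z - 1) <= 4 * (Cmod z * Cmod z * exp (Rabs (Re z))).
Proof.
  pose proof (Ccosh_increment 0 z) as H.
  rewrite Csinh_0, Ccosh_0, Cplus_0_l in H.
  replace (Ccosh z - 1 - z * 0)%C with (Ccosh z - 1)%C in H by ring.
  simpl in H. rewrite Rabs_R0, Rplus_0_l in H. exact H.
Qed.

Lemma Cmod_Csinh (z : C) : Cmod (Csinh z) <= 2 * (Cmod z * exp (Rabs (Re z))).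
Proof.
  replace (Csinh z) with (((Cexp z - 1) - (Cexp (- z) - 1)) / 2)%C by (unfold Csinh; field).
  rewrite Cmod_half.
  pose proof (Cmod_Cexp_sub_1 z) as H1.
  pose proof (Cmod_Cexp_sub_1 (- z)) as H2.
  rewrite Cmod_opp in H2. replace (Rabs (Re (- z)%C)) with (Rabs (Re z)) in H2
    by (simpl; rewrite Rabs_Ropp; reflexivity).
  assert (Cmod (Cexp z - 1 - (Cexp (- z) - 1)) <= Cmod (Cexp z - 1) + Cmod (Cexp (- z) - 1)).
  { eapply Rle_trans; [apply Cmod_triangle|]. rewrite Cmod_opp. lra. }
  lra.
Qed.

(** * Complex cosine and sine, and derivatives of the elementary functions *)

Lemma Ccos_Ccosh (z : C) : Ccos z = Ccosh (Ci * z).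
Proof. reflexivity. Qed.

Lemma Ci_neq_0 : Ci <> 0.
Proof. intros H. injection H. lra. Qed.

Lemma Csin_Csinh (z : C) : Csin z = (Csinh (Ci * z) / Ci)%C.
Proof. unfold Csin, Csinh. field. apply Ci_neq_0. Qed.

Lemma Ci_sqr : (Ci * Ci = -1)%C.
Proof. apply C_ext; simpl; ring. Qed.

Lemma Cmod_Ci : Cmod Ci = 1.
Proof. unfold Cmod; simpl. replace (_ + _) with 1 by ring. apply sqrt_1. Qed.

Lemma Cmod_Csin (z : C) : Cmod (Csin z) = Cmod (Csinh (Ci * z)).
Proof.
  rewrite Csin_Csinh. unfold Cdiv. rewrite Cmod_mult, Cmod_inv by apply Ci_neq_0.
  rewrite Cmod_Ci, Rinv_1. ring.
Qed.

Lemma Cder_Ccosh (f : R -> C) (x : R) (l : C) :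
  Cder f x l -> Cder (fun t => Ccosh (f t)) x (l * Csinh (f x))%C.
Proof.
  intros H. unfold Ccosh, Csinh, Cdiv. eapply Cder_eq.
  - apply Cder_mult; [|apply Cder_const].
    apply Cder_plus; apply Cder_Cexp; [exact H|apply Cder_opp; exact H].
  - cbv beta. ring.
Qed.

Lemma Cder_Csinh (f : R -> C) (x : R) (l : C) :
  Cder f x l -> Cder (fun t => Csinh (f t)) x (l * Ccosh (f x))%C.
Proof.
  intros H. unfold Ccosh, Csinh, Cdiv. eapply Cder_eq.
  - apply Cder_mult; [|apply Cder_const].
    apply Cder_minus; apply Cder_Cexp; [exact H|apply Cder_opp; exact H].
  - cbv beta. ring.
Qed.

Lemma Cder_Ccos (f : R -> C) (x : R) (l : C) :
  Cder f x l -> Cder (fun t => Ccos (f t)) x (- (l * Csin (f x)))%C.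
Proof.
  intros H. eapply Cder_eq.
  - apply (Cder_Ccosh (fun t => Ci * f t)%C). apply Cder_mult; [apply Cder_const|exact H].
  - cbv beta. rewrite Csin_Csinh. unfold Cdiv.
    replace (/ Ci)%C with (- Ci)%C; [ring|].
    apply C_ext; simpl; field.
Qed.

Lemma Cder_Csin (f : R -> C) (x : R) (l : C) :
  Cder f x l -> Cder (fun t => Csin (f t)) x (l * Ccos (f x))%C.
Proof.
  intros H. apply Cder_ext with (fun t => Csinh (Ci * f t) / Ci)%C.
  { intros t. symmetry. apply Csin_Csinh. }
  eapply Cder_eq.
  - unfold Cdiv. apply Cder_mult; [|apply Cder_const].
    apply (Cder_Csinh (fun t => Ci * f t)%C). apply Cder_mult; [apply Cder_const|exact H].
  - cbv beta. rewrite Ccos_Ccosh. field. apply Ci_neq_0.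
Qed.

Lemma Cder_Cpow (f : R -> C) (x : R) (l : C) (n : nat) :
  Cder f x l -> Cder (fun t => f t ^ S n)%C x (RtoC (INR (S n)) * (f x ^ n * l))%C.
Proof.
  intros H. induction n as [|n IH].
  - eapply Cder_ext; [|eapply Cder_eq; [exact H|]].
    + intros t; simpl. ring.
    + simpl. ring.
  - eapply Cder_ext; [|eapply Cder_eq; [apply (Cder_mult _ _ _ _ _ H IH)|]].
    + intros t; simpl. ring.
    + cbv beta. rewrite (S_INR (S n)), RtoC_plus. rewrite !Cpow_S. ring.
Qed.

(** * Wallis-type integrals *)

Lemma Cder_cos (t : R) : Cder (fun t => RtoC (cos t)) t (- RtoC (sin t))%C.
Proof.
  eapply Cder_eq; [apply (Cder_RtoC cos t (- sin t)), is_derive_cos|apply RtoC_opp].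
Qed.

Lemma Cder_sin (t : R) : Cder (fun t => RtoC (sin t)) t (RtoC (cos t)).
Proof. apply (Cder_RtoC sin t (cos t)), is_derive_sin. Qed.

Lemma sin_sqr_C (t : R) : (RtoC (sin t) * RtoC (sin t) = 1 - RtoC (cos t) * RtoC (cos t))%C.
Proof.
  rewrite <- !RtoC_mult, <- RtoC_minus. f_equal.
  pose proof (sin2_cos2 t) as H. unfold Rsqr in H. lra.
Qed.

Lemma ex_Cder_cos_pow (n : nat) (t : R) : exists l, Cder (fun t => RtoC (cos t) ^ n)%C t l.
Proof.
  destruct n as [|n].
  - exists 0. exact (Cder_const 1 t).
  - eexists. apply Cder_Cpow, Cder_cos.
Qed.

Definition wallis_cos (w : C) (n : nat) : R -> C :=
  fun t => (Ccos (RtoC t * w) * RtoC (cos t) ^ n)%C.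
Definition wallis_sin (w : C) (n : nat) : R -> C :=
  fun t => (RtoC t * Csin (RtoC t * w) * RtoC (cos t) ^ n)%C.
(* [wallisC w n] is [I_n] and [wallisS w n] is [- d/dw I_n]. *)
Definition wallisC (w : C) (n : nat) : C := CRIntv (wallis_cos w n) 0 (PI / 2).
Definition wallisS (w : C) (n : nat) : C := CRIntv (wallis_sin w n) 0 (PI / 2).

Lemma ex_Cder_wallis_cos (w : C) (n : nat) (t : R) : exists l, Cder (wallis_cos w n) t l.
Proof.
  destruct (ex_Cder_cos_pow n t) as [l Hl]. eexists.
  apply Cder_mult; [apply Cder_Ccos, Cder_scal_id|exact Hl].
Qed.

Lemma ex_Cder_wallis_sin (w : C) (n : nat) (t : R) : exists l, Cder (wallis_sin w n) t l.
Proof.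
  destruct (ex_Cder_cos_pow n t) as [l Hl]. eexists.
  apply Cder_mult; [apply Cder_mult|exact Hl].
  - apply (Cder_RtoC (fun t => t) t 1), @is_derive_id.
  - apply Cder_Csin, Cder_scal_id.
Qed.

Lemma CRInt_wallisC (w : C) (n : nat) : CRInt (wallis_cos w n) 0 (PI / 2) (wallisC w n).
Proof. apply CRInt_CRIntv, ex_Cder_wallis_cos. Qed.

Lemma CRInt_wallisS (w : C) (n : nat) : CRInt (wallis_sin w n) 0 (PI / 2) (wallisS w n).
Proof. apply CRInt_CRIntv, ex_Cder_wallis_sin. Qed.

(** Takes the place of integration by parts: each recurrence below follows from one primitive [F] of
    a linear combination of Wallis integrands. *)
Lemma wallisC_FTC (w : C) (m n : nat) (p q : C) (F : R -> C) :
  (forall t, Cder F t (p * wallis_cos w m t + q * wallis_cos w n t)%C) ->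
  (p * wallisC w m + q * wallisC w n = F (PI / 2)%R - F 0)%C.
Proof.
  intros HF.
  eapply CRInt_unique.
  - apply CRInt_plus; apply CRInt_scal; apply CRInt_wallisC.
  - apply CRInt_FTC; [exact HF|].
    intros x. destruct (ex_Cder_wallis_cos w m x) as [l Hl].
    destruct (ex_Cder_wallis_cos w n x) as [l' Hl'].
    eexists. apply Cder_plus; (apply Cder_mult; [apply Cder_const|eassumption]).
Qed.

Lemma wallisS_FTC (w : C) (m n k : nat) (p q r : C) (F : R -> C) :
  (forall t, Cder F t (p * wallis_sin w m t + (q * wallis_sin w n t + r * wallis_cos w k t))%C) ->
  (p * wallisS w m + (q * wallisS w n + r * wallisC w k) = F (PI / 2)%R - F 0)%C.
Proof.
  intros HF.
  eapply CRInt_unique.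
  - apply CRInt_plus; [|apply CRInt_plus]; apply CRInt_scal;
      [apply CRInt_wallisS|apply CRInt_wallisS|apply CRInt_wallisC].
  - apply CRInt_FTC; [exact HF|].
    intros x. destruct (ex_Cder_wallis_sin w m x) as [l Hl].
    destruct (ex_Cder_wallis_sin w n x) as [l' Hl'].
    destruct (ex_Cder_wallis_cos w k x) as [l'' Hl''].
    eexists. apply Cder_plus; [|apply Cder_plus]; (apply Cder_mult; [apply Cder_const|eassumption]).
Qed.

Lemma Ccos_0 : Ccos 0 = 1.
Proof. rewrite Ccos_Ccosh, Cmult_0_r. apply Ccosh_0. Qed.

Lemma Csin_0 : Csin 0 = 0.
Proof. rewrite Csin_Csinh, Cmult_0_r, Csinh_0. apply Cmult_0_l. Qed.

Lemma wallisC_1 (w : C) : ((1 - w * w) * wallisC w 1 = Ccos (RtoC (PI / 2) * w))%C.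
Proof.
  pose proof (wallisC_FTC w 1 1 (1 - w * w) 0
    (fun t => Ccos (RtoC t * w) * RtoC (sin t) - w * Csin (RtoC t * w) * RtoC (cos t))%C) as H.
  cbv beta in H.
  rewrite cos_PI2, sin_PI2, sin_0, cos_0, !Cmult_0_l, ?Ccos_0, ?Csin_0 in H.
  replace (Ccos (RtoC (PI / 2) * w)) with
    (Ccos (RtoC (PI / 2) * w) * 1 - w * Csin (RtoC (PI / 2) * w) * 0 - (1 * 0 - w * 0 * 1))%C by ring.
  rewrite <- H; [ring|].
  intros t. eapply Cder_eq.
  - apply Cder_minus; apply Cder_mult.
    + apply Cder_Ccos, Cder_scal_id.
    + apply Cder_sin.
    + apply Cder_mult; [apply Cder_const|apply Cder_Csin, Cder_scal_id].
    + apply Cder_cos.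
  - unfold wallis_cos. simpl. ring.
Qed.

(** The primitive used is the derivative in [w] of the one in [wallisC_1], so the identity is the
    differentiated form of that one. *)
Lemma wallisS_1 (w : C) :
  ((1 - w * w) * wallisS w 1 = RtoC (PI / 2) * Csin (RtoC (PI / 2) * w) - 2 * w * wallisC w 1)%C.
Proof.
  pose proof (wallisS_FTC w 1 1 1 (- (1 - w * w)) 0 (- 2 * w)
    (fun t => - (RtoC t * Csin (RtoC t * w)) * RtoC (sin t)
       - (Csin (RtoC t * w) + RtoC t * (w * Ccos (RtoC t * w))) * RtoC (cos t))%C) as H.
  cbv beta in H.
  rewrite cos_PI2, sin_PI2, sin_0, cos_0, !Cmult_0_l, ?Ccos_0, ?Csin_0 in H.
  set (X := wallisS w 1) in *. set (Y := wallisC w 1) in *.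
  set (S := Csin _) in *.
  replace ((1 - w * w) * X)%C with (- (- (1 - w * w) * X + (0 + -2 * w * Y)) - 2 * w * Y)%C by ring.
  rewrite H; [ring|].
  intros t. eapply Cder_eq.
  - apply Cder_minus; apply Cder_mult.
    + apply Cder_opp, Cder_mult; [apply (Cder_RtoC (fun t => t) t 1), @is_derive_id
        |apply Cder_Csin, Cder_scal_id].
    + apply Cder_sin.
    + apply Cder_plus; [apply Cder_Csin, Cder_scal_id|].
      apply Cder_mult; [apply (Cder_RtoC (fun t => t) t 1), @is_derive_id|].
      apply Cder_mult; [apply Cder_const|apply Cder_Ccos, Cder_scal_id].
    + apply Cder_cos.
  - unfold wallis_cos, wallis_sin. simpl. ring.
Qed.

(** In the primitive [(m+2) cos (t w) cos^(m+1) t sin t - w sin (t w) cos^(m+2) t] every boundary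
    term vanishes, since [cos (PI / 2) = 0], [sin 0 = 0] and [Csin 0 = 0]. *)
Lemma wallisC_rec (w : C) (m : nat) :
  (((RtoC (INR m) + 2) * (RtoC (INR m) + 2) - w * w) * wallisC w (S (S m))
   = (RtoC (INR m) + 2) * (RtoC (INR m) + 1) * wallisC w m)%C.
Proof.
  set (a := RtoC (INR m)).
  pose proof (wallisC_FTC w (S (S m)) m ((a + 2) * (a + 2) - w * w) (- ((a + 2) * (a + 1)))
    (fun t => (a + 2) * Ccos (RtoC t * w) * (RtoC (cos t) ^ S m * RtoC (sin t))
       - w * Csin (RtoC t * w) * RtoC (cos t) ^ S (S m))%C) as H.
  cbv beta in H.
  rewrite cos_PI2, sin_PI2, sin_0, !Cmult_0_l, ?Csin_0, !(Cpow_S (RtoC 0)), !Cmult_0_l in H.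
  set (X := wallisC w (S (S m))) in *. set (Y := wallisC w m) in *.
  replace ((a + 2) * (a + 1) * Y)%C with
    (((a + 2) * (a + 2) - w * w) * X - (((a + 2) * (a + 2) - w * w) * X + - ((a + 2) * (a + 1)) * Y))%C by ring.
  rewrite H; [ring|].
  intros t. eapply Cder_eq.
  - apply Cder_minus; apply Cder_mult.
    + apply Cder_mult; [apply Cder_const|apply Cder_Ccos, Cder_scal_id].
    + apply Cder_mult; [apply Cder_Cpow, Cder_cos|apply Cder_sin].
    + apply Cder_mult; [apply Cder_const|apply Cder_Csin, Cder_scal_id].
    + apply Cder_Cpow, Cder_cos.
  - unfold wallis_cos. rewrite !S_INR, !RtoC_plus. fold a. rewrite !Cpow_S.
    pose proof (sin_sqr_C t) as Hs. ring [Hs].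
Qed.

(** Derivative in [w] of the preceding recurrence, up to sign; the term with [wallisC] comes from
    differentiating the factor [- w * w]. *)
Lemma wallisS_rec (w : C) (m : nat) :
  (((RtoC (INR m) + 2) * (RtoC (INR m) + 2) - w * w) * wallisS w (S (S m))
   = (RtoC (INR m) + 2) * (RtoC (INR m) + 1) * wallisS w m - 2 * w * wallisC w (S (S m)))%C.
Proof.
  set (a := RtoC (INR m)).
  pose proof (wallisS_FTC w (S (S m)) m (S (S m)) (- ((a + 2) * (a + 2) - w * w))
    ((a + 2) * (a + 1)) (- 2 * w)
    (fun t => - (a + 2) * (RtoC t * Csin (RtoC t * w)) * (RtoC (cos t) ^ S m * RtoC (sin t))
       - (Csin (RtoC t * w) + RtoC t * (w * Ccos (RtoC t * w))) * RtoC (cos t) ^ S (S m))%C) as H.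
  cbv beta in H.
  rewrite cos_PI2, sin_PI2, sin_0, !Cmult_0_l, ?Csin_0, !(Cpow_S (RtoC 0)), !Cmult_0_l in H.
  set (X := wallisS w (S (S m))) in *. set (Y := wallisS w m) in *.
  set (Z := wallisC w (S (S m))) in *.
  replace ((a + 2) * (a + 1) * Y - 2 * w * Z)%C with
    (((a + 2) * (a + 2) - w * w) * X + (- ((a + 2) * (a + 2) - w * w) * X
      + ((a + 2) * (a + 1) * Y + -2 * w * Z)))%C by ring.
  rewrite H; [ring|].
  intros t. eapply Cder_eq.
  - apply Cder_minus; apply Cder_mult.
    + apply Cder_mult; [apply Cder_const|].
      apply Cder_mult; [apply (Cder_RtoC (fun t => t) t 1), @is_derive_id
        |apply Cder_Csin, Cder_scal_id].
    + apply Cder_mult; [apply Cder_Cpow, Cder_cos|apply Cder_sin].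
    + apply Cder_plus; [apply Cder_Csin, Cder_scal_id|].
      apply Cder_mult; [apply (Cder_RtoC (fun t => t) t 1), @is_derive_id|].
      apply Cder_mult; [apply Cder_const|apply Cder_Ccos, Cder_scal_id].
    + apply Cder_Cpow, Cder_cos.
  - unfold wallis_cos, wallis_sin. rewrite !S_INR, !RtoC_plus. fold a. rewrite !Cpow_S.
    pose proof (sin_sqr_C t) as Hs. ring [Hs].
Qed.

(** * Size of the Wallis integrals *)

(** The case [w = 0] of [wallisC w n], kept real so that it can serve as the scale of all error
    bounds. *)
Definition wallis (n : nat) : R := RInt (fun t => cos t ^ n) 0 (PI / 2).

Lemma is_RInt_wallis (n : nat) : is_RInt (fun t => cos t ^ n) 0 (PI / 2) (wallis n).
Proof.
  apply (RInt_correct (V := R_CompleteNormedModule)).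
  apply (ex_RInt_continuous (V := R_CompleteNormedModule)). intros x _.
  apply (ex_derive_continuous (V := R_NormedModule)). auto_derive. exact I.
Qed.

Lemma wallis_pos (n : nat) : 0 < wallis n.
Proof.
  pose proof PI_RGT_0. apply RInt_gt_0; [lra| |].
  - intros x Hx. apply pow_lt, cos_gt_0; lra.
  - intros x _. apply (ex_derive_continuous (V := R_NormedModule)). auto_derive. exact I.
Qed.

Lemma is_RInt_wallis_sin_sqr (n : nat) :
  is_RInt (fun t => sin t ^ 2 * cos t ^ n) 0 (PI / 2) (wallis n - wallis (S (S n))).
Proof.
  eapply is_RInt_ext; [|apply (is_RInt_minus (V := R_NormedModule)); apply is_RInt_wallis].
  intros x _. unfold minus, plus, opp; simpl.
  pose proof (sin2_cos2 x) as H. unfold Rsqr in H. 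
  replace (sin x * (sin x * 1)) with (1 - cos x * cos x) by lra. ring.
Qed.

Lemma wallis_rec (n : nat) : (INR n + 2) * wallis (S (S n)) = (INR n + 1) * wallis n.
Proof.
  assert (H : is_RInt (fun t => (INR n + 2) * cos t ^ S (S n) - (INR n + 1) * cos t ^ n) 0 (PI / 2)
     (cos (PI / 2) ^ S n * sin (PI / 2) - cos 0 ^ S n * sin 0)).
  { apply (is_RInt_derive (V := R_CompleteNormedModule) (fun t => cos t ^ S n * sin t)).
    - intros x _. auto_derive; [exact I|].
      pose proof (sin2_cos2 x) as H. unfold Rsqr in H.
      change (match n with O => 1 | S _ => INR n + 1 end) with (INR (S n)).
      change (pred (S n)) with n. rewrite S_INR. simpl pow.
      transitivity ((- (INR n + 1) * cos x ^ n) * (sin x * sin x) + cos x * cos x ^ n * cos x); [ring|].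
      replace (sin x * sin x) with (1 - cos x * cos x) by lra. ring.
    - intros x _. apply (ex_derive_continuous (V := R_NormedModule)). auto_derive. exact I. }
  rewrite cos_PI2, sin_0, pow_ne_zero in H by discriminate.
  assert (G : is_RInt (fun t => (INR n + 2) * cos t ^ S (S n) - (INR n + 1) * cos t ^ n) 0 (PI / 2)
     ((INR n + 2) * wallis (S (S n)) - (INR n + 1) * wallis n)).
  { apply (is_RInt_minus (V := R_NormedModule)); apply (is_RInt_scal (V := R_NormedModule));
      apply is_RInt_wallis. }
  apply (is_RInt_unique (V := R_CompleteNormedModule)) in H.
  apply (is_RInt_unique (V := R_CompleteNormedModule)) in G.
  rewrite H in G. lra.
Qed.

(** The left side is the integral of [sin^2 t cos^n t]. The weight [sin^2] thus gains a factor
    [1 / (n + 2)], and this gain makes the remainders below tend to 0. *)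
Lemma wallis_sub (n : nat) : wallis n - wallis (S (S n)) = wallis n / (INR n + 2).
Proof.
  pose proof (wallis_rec n). pose proof (pos_INR n).
  apply Rmult_eq_reg_l with (INR n + 2); [|lra].
  transitivity (wallis n); [|field]; lra.
Qed.

(** From [sin t >= t - t^3 / 6] and [t^2 <= 4], the latter by [PI <= 4]. *)
Lemma id_le_sin (t : R) : 0 <= t <= PI / 2 -> t <= 3 * sin t.
Proof.
  intros Ht. pose proof PI_4. pose proof PI_RGT_0.
  destruct (pre_sin_bound t 0) as [H1 _]; [lra|lra|].
  assert (H2 : sin_approx t (2 * 0 + 1) = t - t ^ 3 / 6).
  { unfold sin_approx, sin_term; simpl. field. }
  rewrite H2 in H1.
  assert (t ^ 3 <= 4 * t) by (simpl; nra).
  lra.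
Qed.

Lemma Cmod_RtoC_mult (r : R) (z : C) : 0 <= r -> Cmod (RtoC r * z) = r * Cmod z.
Proof. intros Hr. rewrite Cmod_mult, Cmod_R, Rabs_pos_eq; auto. Qed.

Lemma Re_Ci_mult (z : C) : Re (Ci * z) = - Im z.
Proof. simpl. unfold Re, Im. ring. Qed.

Lemma exp_segment_le (w : C) (t : R) : 0 <= t <= PI / 2 ->
  exp (Rabs (Re (Ci * (RtoC t * w)))) <= exp (2 * Cmod w).
Proof.
  intros Ht. pose proof PI_4.
  apply exp_le. eapply Rle_trans; [apply re_le_Cmod|].
  rewrite Cmod_mult, Cmod_Ci, Cmod_RtoC_mult by lra. pose proof (Cmod_ge_0 w). nra.
Qed.

(** One constant for both bounds below. The factor 36 is the 4 of the Taylor bound of [cosh] times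
    the 9 of [t^2 <= 9 sin^2 t]; the summand [|w|^2] serves the cosine, [|w|] the sine, and
    [exp (2 |w|)] uses [t <= 2]. *)
Definition wallis_const (w : C) : R := 36 * (Cmod w + Cmod w * Cmod w) * exp (2 * Cmod w).

Lemma sqr_le_sin_sqr (t : R) : 0 <= t <= PI / 2 -> t * t <= 9 * sin t ^ 2.
Proof.
  intros Ht. pose proof (id_le_sin t Ht). simpl. nra.
Qed.

Lemma wallis_cos_bound (w : C) (t : R) : 0 <= t <= PI / 2 ->
  Cmod (Ccos (RtoC t * w) - 1) <= wallis_const w * sin t ^ 2.
Proof.
  intros Ht. rewrite Ccos_Ccosh.
  eapply Rle_trans; [apply Cmod_Ccosh_sub_1|].
  rewrite Cmod_mult, Cmod_Ci, Cmod_RtoC_mult by lra.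
  pose proof (exp_segment_le w t Ht) as E. pose proof (sqr_le_sin_sqr t Ht) as S.
  pose proof (Cmod_ge_0 w) as W. pose proof (exp_pos (2 * Cmod w)) as P.
  pose proof (exp_pos (Rabs (Re (Ci * (RtoC t * w))))) as P'.
  unfold wallis_const.
  set (c := Cmod w) in *. set (e := exp (2 * c)) in *.
  apply Rle_trans with (4 * (9 * sin t ^ 2 * (c * c) * e)).
  - apply Rmult_le_compat_l; [lra|].
    apply Rmult_le_compat; [|lra| |exact E].
    + pose proof (Rle_0_sqr (1 * (t * c))). unfold Rsqr in *. lra.
    + replace (1 * (t * c) * (1 * (t * c))) with (t * t * (c * c)) by ring.
      apply Rmult_le_compat_r; [nra|exact S].
  - pose proof (pow2_ge_0 (sin t)) as Q.
    assert (0 <= sin t ^ 2 * (c * e)) by (apply Rmult_le_pos; nra). nra.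
Qed.

Lemma wallis_sin_bound (w : C) (t : R) : 0 <= t <= PI / 2 ->
  Cmod (RtoC t * Csin (RtoC t * w)) <= wallis_const w * sin t ^ 2.
Proof.
  intros Ht. rewrite Cmod_RtoC_mult, Cmod_Csin by lra.
  pose proof (Cmod_Csinh (Ci * (RtoC t * w))) as H.
  rewrite Cmod_mult, Cmod_Ci, Cmod_RtoC_mult in H by lra.
  pose proof (exp_segment_le w t Ht) as E. pose proof (sqr_le_sin_sqr t Ht) as S.
  pose proof (Cmod_ge_0 w) as W. pose proof (exp_pos (2 * Cmod w)) as P.
  pose proof (exp_pos (Rabs (Re (Ci * (RtoC t * w))))) as P'.
  unfold wallis_const.
  set (c := Cmod w) in *. set (e := exp (2 * c)) in *.
  apply Rle_trans with (t * (2 * (t * c * e))).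
  - apply Rmult_le_compat_l; [lra|]. eapply Rle_trans; [exact H|].
    rewrite Rmult_1_l.
    apply Rmult_le_compat_l; [lra|]. apply Rmult_le_compat_l; [nra|exact E].
  - pose proof (pow2_ge_0 (sin t)) as Q.
    assert (0 <= c * e) by nra.
    assert (0 <= sin t ^ 2 * (c * e)) by (apply Rmult_le_pos; nra).
    assert (0 <= sin t ^ 2 * (c * c * e)) by (apply Rmult_le_pos; nra).
    assert (t * t * (c * e) <= 9 * sin t ^ 2 * (c * e)) by (apply Rmult_le_compat_r; auto).
    lra.
Qed.

Lemma is_RInt_wallis_const (w : C) (n : nat) :
  is_RInt (fun t => wallis_const w * (sin t ^ 2 * cos t ^ n)) 0 (PI / 2)
    (wallis_const w * (wallis n / (INR n + 2))).
Proof.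
  rewrite <- wallis_sub. apply (is_RInt_scal (V := R_NormedModule)), is_RInt_wallis_sin_sqr.
Qed.

Lemma Cmod_cos_pow (t : R) (n : nat) : 0 <= t <= PI / 2 -> Cmod (RtoC (cos t) ^ n) = cos t ^ n.
Proof.
  intros Ht. rewrite Cmod_pow, Cmod_R, Rabs_pos_eq; [reflexivity|]. apply cos_ge_0; lra.
Qed.

(** The factor [t sin (t w)] is of order [t^2], hence of order [sin^2 t], so [wallis_sub] makes the
    integral small relative to [wallis n]. *)
Lemma wallisS_bound (w : C) (n : nat) :
  Cmod (wallisS w n) <= 2 * (wallis_const w * (wallis n / (INR n + 2))).
Proof.
  pose proof PI_RGT_0.
  eapply CRInt_bound; [|intros t Ht|apply CRInt_wallisS|apply is_RInt_wallis_const]; [lra|].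
  cbv beta. unfold wallis_sin. rewrite Cmod_mult, Cmod_cos_pow, <- Rmult_assoc by lra.
  apply Rmult_le_compat_r; [apply pow_le, cos_ge_0; lra|]. apply wallis_sin_bound. lra.
Qed.

(** For large [n] the weight [cos^n t] concentrates at [t = 0]: replacing [cos (t w)] by 1 costs an
    error of order [sin^2 t]. *)
Lemma wallisC_bound (w : C) (n : nat) :
  Cmod (wallisC w n - RtoC (wallis n)) <= 2 * (wallis_const w * (wallis n / (INR n + 2))).
Proof.
  pose proof PI_RGT_0.
  assert (H0 : CRInt (fun t => RtoC (cos t) ^ n)%C 0 (PI / 2) (RtoC (wallis n))).
  { apply CRInt_ext with (fun t => RtoC (cos t ^ n)).
    - intros x. apply RtoC_pow.
    - split; simpl; [apply is_RInt_wallis|].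
      pose proof (is_RInt_const (V := R_NormedModule) 0 (PI / 2) 0) as K.
      assert (E : @scal R_AbsRing R_NormedModule (PI / 2 - 0) 0 = 0) by apply Rmult_0_r.
      exact (eq_ind _ (is_RInt (V := R_NormedModule) (fun _ => 0) 0 (PI / 2)) K _ E). }
  apply (CRInt_scal (-1)) in H0.
  replace (wallisC w n - RtoC (wallis n))%C with (wallisC w n + (-1) * RtoC (wallis n))%C by ring.
  eapply CRInt_bound;
    [|intros t Ht|apply CRInt_plus; [apply CRInt_wallisC|exact H0]|apply is_RInt_wallis_const]; [lra|].
  cbv beta. unfold wallis_cos.
  replace (Ccos (RtoC t * w) * RtoC (cos t) ^ n + -1 * RtoC (cos t) ^ n)%C with
    ((Ccos (RtoC t * w) - 1) * RtoC (cos t) ^ n)%C by ring.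
  rewrite Cmod_mult, Cmod_cos_pow, <- Rmult_assoc by lra.
  apply Rmult_le_compat_r; [apply pow_le, cos_ge_0; lra|]. apply wallis_cos_bound. lra.
Qed.

(** * The integral of sinh (w x) / sinh x *)

Lemma Cmult_eq_reg_l (r z w : C) : (r * z = r * w)%C -> r <> 0 -> z = w.
Proof.
  intros H Hr. replace z with (/ r * (r * z))%C by (field; exact Hr).
  rewrite H. field. exact Hr.
Qed.

Lemma eq_0_of_le_harmonic (x B : R) : 0 <= x -> (forall n, x <= B / (INR n + 1)) -> x = 0.
Proof.
  intros Hx H. destruct Hx as [Hx|]; [|auto]. exfalso.
  destruct (INR_unbounded (B / x)) as [n Hn].
  specialize (H n). pose proof (pos_INR n).
  assert (B < INR n * x).
  { apply Rmult_lt_compat_r with (r := x) in Hn; auto.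
    unfold Rdiv in Hn. rewrite Rmult_assoc, Rinv_l in Hn; lra. }
  assert (x * (INR n + 1) <= B).
  { apply Rmult_le_compat_r with (r := INR n + 1) in H; [|lra].
    unfold Rdiv in H. rewrite Rmult_assoc, Rinv_l in H; lra. }
  nra.
Qed.

Lemma wallis_const_pos (w : C) : 0 <= wallis_const w.
Proof.
  unfold wallis_const. pose proof (Cmod_ge_0 w). pose proof (exp_pos (2 * Cmod w)).
  apply Rmult_le_pos; [|lra]. nra.
Qed.

(* Any sequence with the increments of the partial fraction expansion of the tangent and limit 0
   agrees with the explicit remainder [wallisS w (2n+1) / wallisC w (2n+1)], which also tends to 0. *)
Lemma tangent_partial_fractions (w : C) (h : nat -> C) (K : R) :
  Ccos (RtoC (PI / 2) * w) <> 0 ->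
  (forall n, RtoC (2 * INR n + 1) * RtoC (2 * INR n + 1) - w * w <> 0)%C ->
  (forall n, h n - h (S n) =
     2 * w / (RtoC (2 * INR n + 1) * RtoC (2 * INR n + 1) - w * w))%C ->
  (forall n, Cmod (h (S n)) <= K / (INR n + 1)) ->
  (h O * Ccos (RtoC (PI / 2) * w) = RtoC (PI / 2) * Csin (RtoC (PI / 2) * w))%C.
Proof.
  intros Hc Hq Hh Hb.
  set (c := Ccos (RtoC (PI / 2) * w)) in *. set (s := Csin (RtoC (PI / 2) * w)).
  set (p := RtoC (PI / 2)).
  (* The discrepancy in the claimed identity; the goal is [D = 0]. *)
  set (D := (p * s / c - h O)%C).
  (* By the two recurrences [wallisS / wallisC] decreases by the same increments as [h], so its
     difference to [h] keeps the value [D]. The product form avoids dividing by [wallisC], whose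
     nonvanishing is not established. *)
  assert (R : forall n, ((D + h (S n)) * wallisC w (2 * n + 1) = wallisS w (2 * n + 1))%C).
  { induction n as [|n IH].
    - specialize (Hh O). specialize (Hq O). simpl (2 * 0 + 1)%nat.
      simpl INR in *. replace (2 * 0 + 1) with 1 in * by ring.
      rewrite Cmult_1_l in *.
      pose proof (wallisC_1 w) as HC. pose proof (wallisS_1 w) as HS.
      fold c in HC. fold s in HS; fold p in HS.
      set (X := wallisC w 1) in *. set (Y := wallisS w 1) in *.
      replace (h 1%nat) with (h O - (h O - h 1%nat))%C by ring. rewrite Hh.
      apply (Cmult_eq_reg_l (1 - w * w)); [|exact Hq].
      transitivity (p * s / c * ((1 - w * w) * X) - 2 * w * X)%C.
      { unfold D. field. split; assumption. }
      rewrite HS, HC. field. exact Hc.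
    - specialize (Hh (S n)). specialize (Hq (S n)).
      replace (2 * S n + 1)%nat with (S (S (2 * n + 1))) by lia.
      pose proof (wallisC_rec w (2 * n + 1)) as HC. pose proof (wallisS_rec w (2 * n + 1)) as HS.
      replace (RtoC (2 * INR (S n) + 1)) with (RtoC (INR (2 * n + 1)) + 2)%C in *.
      2:{ rewrite <- RtoC_plus. f_equal. rewrite S_INR, plus_INR, mult_INR. simpl. ring. }
      set (a := RtoC (INR (2 * n + 1))) in *.
      set (X := wallisC w (S (S (2 * n + 1)))) in *. set (Y := wallisS w (S (S (2 * n + 1)))) in *.
      set (X' := wallisC w (2 * n + 1)) in *. set (Y' := wallisS w (2 * n + 1)) in *.
      replace (h (S (S n))) with (h (S n) - (h (S n) - h (S (S n))))%C by ring. rewrite Hh.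
      apply (Cmult_eq_reg_l ((a + 2) * (a + 2) - w * w)); [|exact Hq].
      rewrite HS, <- IH.
      replace ((a + 2) * (a + 1) * ((D + h (S n)) * X') - 2 * w * X)%C with
        ((D + h (S n)) * ((a + 2) * (a + 1) * X') - 2 * w * X)%C by ring.
      rewrite <- HC. field. exact Hq. }
  (* With [wallisC w N] written as [a] plus an error, [R] bounds [|D| a] by terms that are each at
     most a constant times [a / (n + 1)]. *)
  assert (D0 : Cmod D = 0).
  { set (k := wallis_const w). pose proof (wallis_const_pos w) as k0. fold k in k0.
    apply eq_0_of_le_harmonic with (2 * k + K * (1 + 2 * k) + Cmod D * (2 * k)); [apply Cmod_ge_0|].
    intros n. set (N := (2 * n + 1)%nat).
    pose proof (pos_INR n) as Hn. pose proof (wallis_pos N) as Ha.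
    pose proof (wallisS_bound w N) as HS. pose proof (wallisC_bound w N) as HC.
    fold k in HS, HC.
    set (a := wallis N) in *. set (e := / (INR n + 1)).
    assert (He : 0 < e) by (apply Rinv_0_lt_compat; lra).
    assert (He1 : e <= 1).
    { unfold e. rewrite <- Rinv_1. apply Rinv_le_contravar; lra. }
    assert (Hq' : 2 * (k * (a / (INR N + 2))) <= 2 * k * a * e).
    { replace (2 * k * a * e) with (2 * (k * (a * e))) by ring.
      apply Rmult_le_compat_l; [lra|]. apply Rmult_le_compat_l; [lra|].
      apply Rmult_le_compat_l; [lra|]. apply Rinv_le_contravar; [lra|].
      unfold N. rewrite plus_INR, mult_INR. simpl. lra. }
    specialize (Hb n). change (K / (INR n + 1)) with (K * e) in Hb.
    specialize (R n). fold N in R.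
    assert (E : (D * RtoC a = wallisS w N + (- (h (S n)) * RtoC a
       + - (h (S n)) * (wallisC w N - RtoC a)) + - D * (wallisC w N - RtoC a))%C).
    { rewrite <- R. ring. }
    assert (F : Cmod D * a <= Cmod (wallisS w N) + (Cmod (h (S n)) * a
       + Cmod (h (S n)) * Cmod (wallisC w N - RtoC a)) + Cmod D * Cmod (wallisC w N - RtoC a)).
    { replace (Cmod D * a) with (Cmod (D * RtoC a))
        by (rewrite Cmod_mult, Cmod_R, Rabs_pos_eq; lra).
      rewrite E.
      eapply Rle_trans; [apply Cmod_triangle|]. rewrite Cmod_mult, Cmod_opp.
      apply Rplus_le_compat_r.
      eapply Rle_trans; [apply Cmod_triangle|]. apply Rplus_le_compat_l.
      eapply Rle_trans; [apply Cmod_triangle|].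
      rewrite !Cmod_mult, !Cmod_opp, Cmod_R, Rabs_pos_eq by lra. lra. }
    set (X := Cmod (wallisC w N - RtoC a)) in *.
    pose proof (Cmod_ge_0 D) as D1. pose proof (Cmod_ge_0 (h (S n))) as h1.
    pose proof (Cmod_ge_0 (wallisC w N - RtoC a)) as X1. fold X in X1.
    assert (HX : X <= 2 * k * a * e) by lra.
    assert (HX' : X <= 2 * k * a) by nra.
    assert (T1 : Cmod (h (S n)) * a <= K * e * a) by (apply Rmult_le_compat_r; lra).
    assert (T2 : Cmod (h (S n)) * X <= K * e * (2 * k * a)) by (apply Rmult_le_compat; lra).
    assert (T3 : Cmod D * X <= Cmod D * (2 * k * a * e)) by (apply Rmult_le_compat_l; lra).
    apply Rmult_le_reg_r with a; [lra|].
    unfold Rdiv. fold e. lra. }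
  apply Cmod_eq_0 in D0. unfold D in D0.
  replace (h O) with (p * s / c - (p * s / c - h O))%C by ring. rewrite D0. field. exact Hc.
Qed.

Lemma Re_Ccos (z : C) : Re (Ccos z) = cos (Re z) * cosh (Im z).
Proof.
  unfold Ccos, Cexp, cosh. destruct z as [x y]; simpl.
  replace (0 * x - 1 * y) with (- y) by ring. replace (0 * y + 1 * x) with x by ring.
  rewrite cos_neg, Ropp_involutive. field.
Qed.

Lemma cosh_pos (x : R) : 0 < cosh x.
Proof. unfold cosh. pose proof (exp_pos x). pose proof (exp_pos (- x)). lra. Qed.

(** The real part is a cosine of an angle in [(- PI / 2, PI / 2)] times a value of [cosh]. *)
Lemma Ccos_half_pi_pos (w : C) : Rabs (Re w) < 1 -> 0 < Re (Ccos (RtoC (PI / 2) * w)).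
Proof.
  intros H. rewrite Re_Ccos, Re_RtoC_mult. apply Rabs_def2 in H. pose proof PI_RGT_0.
  apply Rmult_lt_0_compat; [apply cos_gt_0; nra|apply cosh_pos].
Qed.

Lemma Ccos_half_pi_neq_0 (w : C) : Rabs (Re w) < 1 -> Ccos (RtoC (PI / 2) * w) <> 0.
Proof. intros H E. pose proof (Ccos_half_pi_pos w H) as P. rewrite E in P. simpl in P. lra. Qed.

(** Amounts to [(1 + 2 x) exp (- x) <= exp x], that is [1 + 2 x <= exp (2 x)]. It captures at once
    the behaviour like [x] near 0 and like [exp x] at infinity. *)
Lemma sinh_lower (x : R) : 0 < x -> x * exp x <= (1 + 2 * x) * sinh x.
Proof.
  intros Hx. unfold sinh.
  pose proof (exp_ineq1_le (2 * x)) as H.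
  assert (E : exp (2 * x) = exp x * exp x) by (rewrite <- exp_plus; f_equal; ring).
  assert (F : exp x * exp (- x) = 1) by (rewrite <- exp_plus, Rplus_opp_r; apply exp_0).
  rewrite E in H. pose proof (exp_pos (- x)) as P. pose proof (exp_pos x) as P'.
  assert (G : (1 + 2 * x) * exp (- x) <= exp x).
  { apply Rmult_le_compat_r with (r := exp (- x)) in H; [|lra].
    replace (exp x * exp x * exp (- x)) with (exp x * (exp x * exp (- x))) in H by ring.
    rewrite F in H. lra. }
  lra.
Qed.

Lemma sinh_pos (x : R) : 0 < x -> 0 < sinh x.
Proof.
  intros Hx. pose proof (sinh_lower x Hx). pose proof (exp_pos x). nra.
Qed.

(** The factor [x] removes the singularity at 0. Half of the gap [1 - r] absorbs the polynomial
    [1 + 2 x] left by [sinh_lower]; the other half remains as the decay rate. *)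
Lemma x_div_sinh_decay (r x : R) : r < 1 -> 0 < x ->
  x * / sinh x * exp (r * x) <= (1 + 4 / (1 - r)) * exp (- ((1 - r) / 2 * x)).
Proof.
  intros Hr Hx. set (d := (1 - r) / 2).
  assert (Hd : 0 < d) by (unfold d; lra).
  pose proof (sinh_lower x Hx) as L. pose proof (sinh_pos x Hx) as P.
  replace (4 / (1 - r)) with (2 / d) by (unfold d; field; lra).
  assert (A1 : x * / sinh x <= (1 + 2 * x) * exp (- x)).
  { apply Rmult_le_reg_r with (sinh x); auto.
    rewrite Rmult_assoc, Rinv_l, Rmult_1_r by lra.
    assert (F : exp x * exp (- x) = 1) by (rewrite <- exp_plus, Rplus_opp_r; apply exp_0).
    apply Rmult_le_compat_r with (r := exp (- x)) in L; [|left; apply exp_pos].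
    rewrite Rmult_assoc, F in L. lra. }
  assert (A2 : 1 + 2 * x <= (1 + 2 / d) * exp (d * x)).
  { pose proof (exp_ineq1_le (d * x)) as E.
    assert (0 < d * x) by (apply Rmult_lt_0_compat; auto).
    assert (Q : 2 / d * (d * x) = 2 * x) by (field; lra).
    assert (0 < 2 / d) by (apply Rdiv_lt_0_compat; lra). nra. }
  assert (E : exp (- (d * x)) = exp (d * x) * exp (- x) * exp (r * x)).
  { rewrite <- !exp_plus. f_equal. unfold d. field. }
  rewrite E.
  rewrite <- !Rmult_assoc. apply Rmult_le_compat_r; [left; apply exp_pos|].
  eapply Rle_trans; [exact A1|]. apply Rmult_le_compat_r; [left; apply exp_pos|exact A2].
Qed.

(** For [n = 0] this is the integrand of [h(w)]; in general it is what is left of it after removing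
    the first [n] terms of the expansion of [1 / sinh x]. *)
Definition sinh_ratio (w : C) (n : nat) (x : R) : C :=
  (Csinh (RtoC x * w) * RtoC (/ sinh x) * Cexp (- (RtoC x * RtoC (2 * INR n))))%C.

Lemma is_derive_inv_sinh (x : R) : 0 < x ->
  is_derive (fun x => / sinh x) x (- cosh x / (sinh x * sinh x)).
Proof.
  intros Hx. pose proof (sinh_pos x Hx) as P.
  unfold sinh, cosh in *. auto_derive; [lra|]. field. lra.
Qed.

Lemma ex_Cder_sinh_ratio (w : C) (n : nat) (x : R) : 0 < x ->
  exists l, Cder (sinh_ratio w n) x l.
Proof.
  intros Hx. eexists. apply Cder_mult; [apply Cder_mult|].
  - apply Cder_Csinh, Cder_scal_id.
  - apply (Cder_RtoC (fun x => / sinh x)), is_derive_inv_sinh. exact Hx.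
  - apply Cder_Cexp, Cder_opp, Cder_scal_id.
Qed.

(** The decay rate grows like [2 n], so the integral of the remainder is of order [1 / n]. *)
Lemma sinh_ratio_bound (w : C) (n : nat) (x : R) : Rabs (Re w) < 1 -> 0 < x ->
  Cmod (sinh_ratio w n x) <= 2 * Cmod w * (1 + 4 / (1 - Rabs (Re w)))
     * exp (- (((1 - Rabs (Re w)) / 2 + 2 * INR n) * x)).
Proof.
  intros Hw Hx. unfold sinh_ratio. set (r := Rabs (Re w)) in *.
  pose proof (sinh_pos x Hx) as P.
  rewrite !Cmod_mult, Cmod_R, Cmod_Cexp, Rabs_pos_eq by (left; apply Rinv_0_lt_compat; auto).
  replace (Re (- (RtoC x * RtoC (2 * INR n)))) with (- (2 * INR n * x)) by (simpl; ring).
  replace (- (((1 - r) / 2 + 2 * INR n) * x)) with (- ((1 - r) / 2 * x) + - (2 * INR n * x)) by ring.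
  rewrite exp_plus, <- Rmult_assoc. apply Rmult_le_compat_r; [left; apply exp_pos|].
  pose proof (Cmod_Csinh (RtoC x * w)) as H.
  rewrite Cmod_RtoC_mult, Re_RtoC_mult, Rabs_mult, (Rabs_pos_eq x) in H by lra. fold r in H.
  pose proof (x_div_sinh_decay r x Hw Hx) as E.
  assert (P' : 0 < / sinh x) by (apply Rinv_0_lt_compat; auto).
  eapply Rle_trans; [apply Rmult_le_compat_r; [lra|exact H]|].
  replace (2 * (x * Cmod w * exp (x * r)) * / sinh x) with
    (2 * Cmod w * (x * / sinh x * exp (r * x))) by (rewrite (Rmult_comm r x); ring).
  rewrite (Rmult_assoc (2 * Cmod w)). apply Rmult_le_compat_l; [|exact E].
  pose proof (Cmod_ge_0 w). lra.
Qed.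

Lemma sinh_ratio_rate_pos (w : C) (n : nat) : Rabs (Re w) < 1 ->
  0 < (1 - Rabs (Re w)) / 2 + 2 * INR n.
Proof. intros H. pose proof (pos_INR n). lra. Qed.

Lemma CInt_sinh_ratio (w : C) (n : nat) : Rabs (Re w) < 1 ->
  CInt (sinh_ratio w n) (CIntv (sinh_ratio w n)).
Proof.
  intros Hw. eapply CInt_CIntv.
  - apply (sinh_ratio_rate_pos w n Hw).
  - intros x Hx. apply sinh_ratio_bound; auto.
  - intros x Hx. apply ex_Cder_sinh_ratio. exact Hx.
Qed.

Lemma Csinh_R (x : R) : Csinh (RtoC x) = RtoC (sinh x).
Proof.
  unfold Csinh, Cexp, sinh. apply C_ext; simpl;
    rewrite ?Ropp_0, ?cos_0, ?sin_0; field.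
Qed.

(** The factor [1 - exp (- 2 x) = 2 exp (- x) sinh x] cancels the denominator, and two pure
    exponentials remain. *)
Lemma sinh_ratio_telescope (w : C) (n : nat) (x : R) : 0 < x ->
  (sinh_ratio w n x - sinh_ratio w (S n) x =
   Cexp (- (RtoC x * (RtoC (2 * INR n + 1) - w))) -
   Cexp (- (RtoC x * (RtoC (2 * INR n + 1) + w))))%C.
Proof.
  intros Hx. pose proof (sinh_pos x Hx) as P.
  assert (N0 : RtoC (sinh x) <> 0) by (intros E; injection E; lra).
  unfold sinh_ratio. rewrite RtoC_inv by lra.
  rewrite S_INR.
  set (q := Cexp (- (RtoC x * RtoC (2 * INR n)))).
  replace (Cexp (- (RtoC x * RtoC (2 * (INR n + 1))))) with (q * Cexp (- x) * Cexp (- x))%C.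
  2:{ unfold q. rewrite <- !Cexp_plus. f_equal.
      rewrite !RtoC_mult, !RtoC_plus. ring. }
  replace (Cexp (- (RtoC x * (RtoC (2 * INR n + 1) - w)))) with (q * Cexp (- x) * Cexp (RtoC x * w))%C.
  2:{ unfold q. rewrite <- !Cexp_plus. f_equal. rewrite RtoC_plus. ring. }
  replace (Cexp (- (RtoC x * (RtoC (2 * INR n + 1) + w)))) with (q * Cexp (- x) * Cexp (- (RtoC x * w)))%C.
  2:{ unfold q. rewrite <- !Cexp_plus. f_equal. rewrite RtoC_plus. ring. }
  apply (Cmult_eq_reg_l (RtoC (sinh x))); [|exact N0].
  transitivity (Csinh (RtoC x * w) * q * (1 - Cexp (- x) * Cexp (- x)))%C; [field; exact N0|].
  rewrite <- Csinh_R. unfold Csinh.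
  replace (RtoC 1) with (Cexp x * Cexp (- x))%C by apply Cexp_opp.
  field.
Qed.

Lemma Re_odd_sub_pos (w : C) (n : nat) : Rabs (Re w) < 1 -> 0 < Re (RtoC (2 * INR n + 1) - w).
Proof.
  intros H. apply Rabs_def2 in H. pose proof (pos_INR n). unfold Re in *; simpl. lra.
Qed.

Lemma Re_odd_add_pos (w : C) (n : nat) : Rabs (Re w) < 1 -> 0 < Re (RtoC (2 * INR n + 1) + w).
Proof.
  intros H. apply Rabs_def2 in H. pose proof (pos_INR n). unfold Re in *; simpl. lra.
Qed.

Lemma neq_0_of_Re_pos (z : C) : 0 < Re z -> z <> 0.
Proof. intros H ->. simpl in H. lra. Qed.

(** The integrals of the remainders form a sequence as in [tangent_partial_fractions]: the
    telescoped exponentials integrate to [1 / (2n+1-w) - 1 / (2n+1+w)]. *)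
Lemma CIntv_sinh_ratio (w : C) : Rabs (Re w) < 1 ->
  (CIntv (sinh_ratio w 0) * Ccos (RtoC (PI / 2) * w) = RtoC (PI / 2) * Csin (RtoC (PI / 2) * w))%C.
Proof.
  intros Hw.
  assert (N1 : forall n, (RtoC (2 * INR n + 1) - w)%C <> 0)
    by (intros; apply neq_0_of_Re_pos, Re_odd_sub_pos, Hw).
  assert (N2 : forall n, (RtoC (2 * INR n + 1) + w)%C <> 0)
    by (intros; apply neq_0_of_Re_pos, Re_odd_add_pos, Hw).
  assert (N3 : forall n, (RtoC (2 * INR n + 1) * RtoC (2 * INR n + 1) - w * w)%C <> 0).
  { intros n. replace (_ - w * w)%C with
      ((RtoC (2 * INR n + 1) - w) * (RtoC (2 * INR n + 1) + w))%C by ring.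
    apply Cmult_neq_0; auto. }
  apply (tangent_partial_fractions w (fun n => CIntv (sinh_ratio w n))
    (2 * Cmod w * (1 + 4 / (1 - Rabs (Re w))))); auto.
  - apply Ccos_half_pi_neq_0, Hw.
  - intros n.
    eapply CInt_unique.
    + apply CInt_minus; apply CInt_sinh_ratio; exact Hw.
    + eapply CInt_ext; [intros x Hx; symmetry; apply sinh_ratio_telescope; exact Hx|].
      replace (2 * w / (RtoC (2 * INR n + 1) * RtoC (2 * INR n + 1) - w * w))%C with
        (/ (RtoC (2 * INR n + 1) - w) - / (RtoC (2 * INR n + 1) + w))%C
        by (field; auto).
      apply CInt_minus; apply CInt_exp; [apply Re_odd_sub_pos|apply Re_odd_add_pos]; exact Hw.
  - intros n. cbv beta.
    pose proof (sinh_ratio_rate_pos w (S n) Hw) as Hd.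
    eapply Rle_trans; [eapply CInt_bound; [exact Hd| |apply CInt_sinh_ratio; exact Hw]|].
    + intros x Hx. apply sinh_ratio_bound; auto.
    + set (M := 2 * Cmod w * (1 + 4 / (1 - Rabs (Re w)))).
      assert (0 <= M).
      { unfold M. pose proof (Cmod_ge_0 w).
        assert (0 < 4 / (1 - Rabs (Re w))) by (apply Rdiv_lt_0_compat; lra). nra. }
      set (d := (1 - Rabs (Re w)) / 2 + 2 * INR (S n)) in *.
      pose proof (pos_INR n).
      (* The rate at index [n + 1] is at least [2 (n + 1)], which makes up for the factor 2 of
         [CInt_bound]. *)
      replace (2 * (M / d)) with (M * / (d / 2)) by (field; lra).
      apply Rmult_le_compat_l; auto. apply Rinv_le_contravar; [lra|].
      unfold d. rewrite S_INR. lra.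
Qed.

(** * The integral of (cosh (w x) - 1) / (x sinh x) *)

Definition cosh_kernel (w : C) (x : R) : C :=
  ((Ccosh (RtoC x * w) - 1) * RtoC (/ sinh x) * RtoC (/ x))%C.

(** Subtracting 1 makes the numerator vanish to order [x^2] at 0, which compensates both [/ sinh x]
    and [/ x]. *)
Lemma cosh_kernel_bound (w : C) (x : R) : Rabs (Re w) < 1 -> 0 < x ->
  Cmod (cosh_kernel w x) <= 4 * (Cmod w * Cmod w) * (1 + 4 / (1 - Rabs (Re w)))
     * exp (- ((1 - Rabs (Re w)) / 2 * x)).
Proof.
  intros Hw Hx. unfold cosh_kernel. set (r := Rabs (Re w)) in *.
  pose proof (sinh_pos x Hx) as P.
  assert (P' : 0 < / sinh x) by (apply Rinv_0_lt_compat; auto).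
  assert (P'' : 0 < / x) by (apply Rinv_0_lt_compat; auto).
  rewrite !Cmod_mult, !Cmod_R, !Rabs_pos_eq by lra.
  pose proof (Cmod_Ccosh_sub_1 (RtoC x * w)) as H.
  rewrite Cmod_RtoC_mult, Re_RtoC_mult, Rabs_mult, (Rabs_pos_eq x) in H by lra. fold r in H.
  pose proof (x_div_sinh_decay r x Hw Hx) as E.
  apply Rle_trans with (4 * (x * Cmod w * (x * Cmod w) * exp (x * r)) * / sinh x * / x).
  { apply Rmult_le_compat_r; [lra|]. apply Rmult_le_compat_r; [lra|exact H]. }
  replace (4 * (x * Cmod w * (x * Cmod w) * exp (x * r)) * / sinh x * / x)
    with (4 * (Cmod w * Cmod w) * (x * / sinh x * exp (r * x)))
    by (rewrite (Rmult_comm r x); field; lra).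
  rewrite (Rmult_assoc (4 * (Cmod w * Cmod w))). apply Rmult_le_compat_l; [|exact E].
  pose proof (Cmod_ge_0 w). nra.
Qed.

(** Differentiating [cosh (w x)] in [w] produces a factor [x] that cancels [/ x], so the derivative
    of the kernel is [sinh_ratio]. The error is quadratic in [e], with an integrable bound uniform
    for fixed [r < 1]. *)
Lemma cosh_kernel_increment (z e : C) (r x : R) :
  Rabs (Re z) + Rabs (Re e) <= r -> r < 1 -> 0 < x ->
  Cmod (cosh_kernel (z + e) x - cosh_kernel z x - e * sinh_ratio z 0 x)
   <= 4 * (Cmod e * Cmod e) * (1 + 4 / (1 - r)) * exp (- ((1 - r) / 2 * x)).
Proof.
  intros Hr Hr1 Hx.
  pose proof (sinh_pos x Hx) as P.
  assert (P' : 0 < / sinh x) by (apply Rinv_0_lt_compat; auto).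
  assert (P'' : 0 < / x) by (apply Rinv_0_lt_compat; auto).
  assert (x0 : RtoC x <> 0) by (intros E; injection E; lra).
  replace (cosh_kernel (z + e) x - cosh_kernel z x - e * sinh_ratio z 0 x)%C with
    ((Ccosh (RtoC x * z + RtoC x * e) - Ccosh (RtoC x * z) - RtoC x * e * Csinh (RtoC x * z))
      * RtoC (/ sinh x) * RtoC (/ x))%C.
  2:{ unfold cosh_kernel, sinh_ratio. simpl INR. rewrite Rmult_0_r, Cmult_0_r.
      replace (- 0)%C with (RtoC 0) by ring. rewrite Cexp_0, Cmult_plus_distr_l.
      rewrite (RtoC_inv x) by lra. field. exact x0. }
  rewrite !Cmod_mult, !Cmod_R, !Rabs_pos_eq by lra.
  pose proof (Ccosh_increment (RtoC x * z) (RtoC x * e)) as H.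
  rewrite Cmod_RtoC_mult, !Re_RtoC_mult, !Rabs_mult, (Rabs_pos_eq x) in H by lra.
  pose proof (x_div_sinh_decay r x Hr1 Hx) as E.
  pose proof (Cmod_ge_0 e) as E0.
  assert (X : exp (x * Rabs (Re z) + x * Rabs (Re e)) <= exp (r * x)) by (apply exp_le; nra).
  apply Rle_trans with (4 * (x * Cmod e * (x * Cmod e) * exp (r * x)) * / sinh x * / x).
  { apply Rmult_le_compat_r; [lra|]. apply Rmult_le_compat_r; [lra|].
    eapply Rle_trans; [exact H|]. apply Rmult_le_compat_l; [lra|].
    apply Rmult_le_compat_l; [|exact X].
    pose proof (Rle_0_sqr (x * Cmod e)) as Q. exact Q. }
  replace (4 * (x * Cmod e * (x * Cmod e) * exp (r * x)) * / sinh x * / x)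
    with (4 * (Cmod e * Cmod e) * (x * / sinh x * exp (r * x)))
    by (field; lra).
  rewrite (Rmult_assoc (4 * (Cmod e * Cmod e))). apply Rmult_le_compat_l; [nra|exact E].
Qed.

Lemma CInt_cosh_kernel (w : C) : Rabs (Re w) < 1 ->
  CInt (cosh_kernel w) (CIntv (cosh_kernel w)).
Proof.
  intros Hw. apply CInt_CIntv with (4 * (Cmod w * Cmod w) * (1 + 4 / (1 - Rabs (Re w))))
    ((1 - Rabs (Re w)) / 2); [lra| |].
  - intros x Hx. apply cosh_kernel_bound; auto.
  - intros x Hx. eexists. apply Cder_mult; [apply Cder_mult|].
    + apply Cder_minus; [apply Cder_Ccosh, Cder_scal_id|apply Cder_const].
    + apply (Cder_RtoC (fun x => / sinh x)), is_derive_inv_sinh. exact Hx.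
    + apply (Cder_RtoC (fun x => / x) x (- / x ^ 2)). auto_derive; [lra|field; lra].
Qed.

(** The function [G(w)]; it turns out to be a logarithm of [1 / cos (PI w / 2)]. *)
Definition log_sec (w : C) : C := CIntv (cosh_kernel w).

Lemma log_sec_0 : log_sec 0 = 0.
Proof.
  assert (H0 : Rabs (Re 0) < 1) by (simpl; rewrite Rabs_R0; lra).
  apply Cmod_eq_0. apply Rle_antisym; [|apply Cmod_ge_0].
  eapply Rle_trans.
  - eapply CInt_bound; [|intros x Hx; apply cosh_kernel_bound; [exact H0|exact Hx]
      |apply CInt_cosh_kernel; exact H0]. lra.
  - rewrite Cmod_0. right. unfold Rdiv at 1. ring.
Qed.

(** The kernel estimate integrated: 16 is the 4 of that estimate, times 2 from [CInt_bound], times 2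
    from the rate [(1 - r) / 2]. *)
Lemma log_sec_increment (z e : C) (r : R) :
  Rabs (Re z) + Rabs (Re e) <= r -> r < 1 ->
  Cmod (log_sec (z + e) - log_sec z - e * CIntv (sinh_ratio z 0))
   <= 16 * (1 + 4 / (1 - r)) / (1 - r) * (Cmod e * Cmod e).
Proof.
  intros Hr Hr1.
  assert (Hz : Rabs (Re z) < 1) by (pose proof (Rabs_pos (Re e)); lra).
  assert (Hze : Rabs (Re (z + e)) < 1).
  { eapply Rle_lt_trans; [apply Rabs_triang|]. unfold Re in *. lra. }
  eapply Rle_trans.
  - eapply (CInt_bound _ (4 * (Cmod e * Cmod e) * (1 + 4 / (1 - r))) ((1 - r) / 2));
      [lra|intros x Hx; apply (cosh_kernel_increment z e r x); auto|].
    apply CInt_minus; [apply CInt_minus; apply CInt_cosh_kernel; assumption|].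
    apply CInt_scal, CInt_sinh_ratio. exact Hz.
  - right. field. lra.
Qed.

(** The difference quotient deviates from [l] by at most [K |s - t|]; this takes the place of a
    dominated convergence argument. *)
Lemma is_derive_of_quadratic_error (f : R -> R) (t l K d : R) : 0 < d -> 0 <= K ->
  (forall s, Rabs (s - t) < d -> Rabs (f s - f t - (s - t) * l) <= K * ((s - t) * (s - t))) ->
  is_derive f t l.
Proof.
  intros Hd HK H. apply is_derive_Reals. intros eps He.
  assert (Hd' : 0 < Rmin d (eps / (K + 1))).
  { apply Rmin_glb_lt; auto. apply Rdiv_lt_0_compat; lra. }
  exists (mkposreal _ Hd'). simpl. intros h Hh Hhd.
  specialize (H (t + h)). replace (t + h - t) with h in H by ring.
  assert (H1 : Rabs h < d) by (eapply Rlt_le_trans; [exact Hhd|apply Rmin_l]).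
  assert (H2 : Rabs h < eps / (K + 1)) by (eapply Rlt_le_trans; [exact Hhd|apply Rmin_r]).
  specialize (H H1).
  replace ((f (t + h) - f t) / h - l) with ((f (t + h) - f t - h * l) * / h) by (field; auto).
  rewrite Rabs_mult, Rabs_inv.
  assert (Hp : 0 < Rabs h) by (apply Rabs_pos_lt; auto).
  replace (h * h) with (Rabs h * Rabs h) in H by (rewrite <- Rabs_mult; apply Rabs_pos_eq; nra).
  apply Rle_lt_trans with (K * Rabs h).
  - apply Rmult_le_reg_r with (Rabs h); auto.
    rewrite Rmult_assoc, Rinv_l by lra. lra.
  - assert ((K + 1) * Rabs h < eps).
    { apply Rmult_lt_compat_l with (r := K + 1) in H2; [|lra].
      replace ((K + 1) * (eps / (K + 1))) with eps in H2 by (field; lra). lra. }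
    nra.
Qed.

Lemma Rabs_Re_scale (t : R) (w : C) : 0 <= t <= 1 -> Rabs (Re w) < 1 -> Rabs (Re (RtoC t * w)) < 1.
Proof.
  intros Ht Hw. rewrite Re_RtoC_mult, Rabs_mult, (Rabs_pos_eq t) by lra.
  pose proof (Rabs_pos (Re w)). nra.
Qed.

Lemma Cder_log_sec (w : C) (t : R) : 0 <= t <= 1 -> Rabs (Re w) < 1 ->
  Cder (fun t => log_sec (RtoC t * w)) t (w * CIntv (sinh_ratio (RtoC t * w) 0))%C.
Proof.
  intros Ht Hw. pose proof (Rabs_Re_scale t w Ht Hw) as H0.
  (* [r] lies midway between [r0] and 1, and [d = r - r0]. As [|Re w| < 1], moving the parameter by
     less than [d] keeps the sum of real parts below [r]. *)
  set (r0 := Rabs (Re (RtoC t * w))) in *. set (r := (1 + r0) / 2).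
  set (d := (1 - r0) / 2).
  set (K := 16 * (1 + 4 / (1 - r)) / (1 - r) * (Cmod w * Cmod w)).
  assert (Hr : r < 1) by (unfold r; lra).
  assert (HK : 0 <= K).
  { assert (0 < 4 / (1 - r)) by (apply Rdiv_lt_0_compat; lra).
    unfold K. apply Rmult_le_pos; [|apply Rle_0_sqr].
    apply Rmult_le_pos; [lra|]. left; apply Rinv_0_lt_compat; lra. }
  assert (B : forall s, Rabs (s - t) < d ->
    Cmod (log_sec (RtoC s * w) - log_sec (RtoC t * w)
        - RtoC (s - t) * (w * CIntv (sinh_ratio (RtoC t * w) 0))) <= K * ((s - t) * (s - t))).
  { intros s Hs.
    pose proof (log_sec_increment (RtoC t * w) (RtoC (s - t) * w) r) as H.
    replace (RtoC t * w + RtoC (s - t) * w)%C with (RtoC s * w)%C in H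
      by (rewrite RtoC_minus; ring).
    rewrite Cmod_mult, Cmod_R in H.
    replace (Rabs (s - t) * Cmod w * (Rabs (s - t) * Cmod w)) with
      ((s - t) * (s - t) * (Cmod w * Cmod w)) in H.
    2:{ transitivity (Rabs (s - t) * Rabs (s - t) * (Cmod w * Cmod w)); [|ring].
        rewrite <- Rabs_mult, Rabs_pos_eq; [reflexivity|apply Rle_0_sqr]. }
    rewrite Cmult_assoc. eapply Rle_trans; [apply H; auto|unfold K; lra].
    fold r0. rewrite Re_RtoC_mult, Rabs_mult.
    pose proof (Rabs_pos (Re w)). pose proof (Rabs_pos (s - t)).
    unfold r, d in *. nra. }
  split; (eapply is_derive_of_quadratic_error with (K := K) (d := d); [unfold d; lra|exact HK|]);
    intros s Hs; specialize (B s Hs).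
  - eapply Rle_trans; [|exact B]. eapply Rle_trans; [|apply re_le_Cmod].
    right. f_equal. simpl. unfold Re. ring.
  - eapply Rle_trans; [|exact B]. eapply Rle_trans; [|apply Im_le_Cmod].
    right. f_equal. simpl. unfold Im. ring.
Qed.

(** Along [t w] the logarithmic derivatives of the two factors cancel by [CIntv_sinh_ratio], and the
    product is 1 at [t = 0]. *)
Lemma Cexp_log_sec (w : C) : Rabs (Re w) < 1 ->
  (Cexp (log_sec w) * Ccos (RtoC (PI / 2) * w) = 1)%C.
Proof.
  intros Hw.
  set (E := fun t => (Cexp (log_sec (RtoC t * w)) * Ccos (RtoC t * (RtoC (PI / 2) * w)))%C).
  assert (H : E 0 = E 1).
  { apply Cder_zero_eq; [lra|]. intros t Ht. eapply Cder_eq.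
    - apply Cder_mult.
      + apply Cder_Cexp. apply Cder_log_sec; auto.
      + apply Cder_Ccos, Cder_scal_id.
    - cbv beta.
      pose proof (CIntv_sinh_ratio (RtoC t * w) (Rabs_Re_scale t w Ht Hw)) as T.
      replace (RtoC (PI / 2) * (RtoC t * w))%C with (RtoC t * (RtoC (PI / 2) * w))%C in T by ring.
      set (h := CIntv _) in *. set (c := Ccos _) in *. set (s := Csin _) in *. set (e := Cexp _).
      replace (w * h * e * c + e * - (RtoC (PI / 2) * w * s))%C with
        (w * e * (h * c - RtoC (PI / 2) * s))%C by ring.
      rewrite T. ring. }
  unfold E in H. rewrite !Cmult_0_l, !Cmult_1_l, log_sec_0, Cexp_0, Ccos_0 in H.
  rewrite <- H. ring.
Qed.

(** * Principal logarithm, addition formulas and the excluded half-line *)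

(** On [(- PI, PI)] the sign of [sin (Im z)] follows that of [Im z], so the test in [Carg] picks the
    branch on which [acos] inverts [cos]. *)
Lemma Cln_Cexp (z : C) : - PI < Im z < PI -> Cln (Cexp z) = z.
Proof.
  intros Hz. unfold Cln, Carg. rewrite Cmod_Cexp, ln_exp.
  pose proof (exp_pos (Re z)) as P.
  assert (E : Re (Cexp z) / exp (Re z) = cos (Im z)) by (simpl; field; lra).
  rewrite E. apply C_ext; [reflexivity|]. simpl.
  destruct (Rle_dec 0 (exp (Re z) * sin (Im z))) as [H|H].
  - destruct (Rle_lt_dec 0 (Im z)) as [Hi|Hi]; [apply acos_cos; lra|].
    exfalso. pose proof (sin_lt_0_var (Im z) ltac:(lra) Hi). nra.
  - destruct (Rle_lt_dec 0 (Im z)) as [Hi|Hi].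
    + exfalso. apply H. apply Rmult_le_pos; [lra|]. apply sin_ge_0; lra.
    + rewrite <- cos_neg, acos_cos by lra. ring.
Qed.

(** With [b = PI beta / 2] and [A = PI a] the left side is the product of the cosines belonging to
    [beta + 2ia] and [beta - 2ia]. *)
Lemma Ccos_mul_Ccos (b A : C) :
  (Ccos (b + Ci * A) * Ccos (b - Ci * A) = Ccos b * Ccos b + Csinh A * Csinh A)%C.
Proof.
  unfold Ccos, Csinh.
  replace (Ci * (b + Ci * A))%C with (Ci * b + (Ci * Ci) * A)%C by ring.
  replace (Ci * (b - Ci * A))%C with (Ci * b - (Ci * Ci) * A)%C by ring.
  rewrite Ci_sqr. set (B := (Ci * b)%C).
  replace (B + -1 * A)%C with (B + - A)%C by ring.
  replace (B - -1 * A)%C with (B + A)%C by ring.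
  replace (- (B + - A))%C with (- B + A)%C by ring.
  replace (- (B + A))%C with (- B + - A)%C by ring.
  rewrite !Cexp_plus.
  pose proof (Cexp_opp A) as HA. pose proof (Cexp_opp B) as HB.
  set (X := Cexp A) in *. set (X' := Cexp (- A)) in *.
  set (Y := Cexp B) in *. set (Y' := Cexp (- B)) in *.
  (* The terms are grouped so that [X * X'] and [Y * Y'] stand as blocks, ready to be replaced by
     1. *)
  transitivity ((Y * Y * (X * X') + Y' * Y' * (X * X') + (Y * Y') * (X * X) + (Y * Y') * (X' * X')) / 4)%C;
    [field|].
  transitivity ((Y * Y + 2 * (Y * Y') + Y' * Y' + X * X - 2 * (X * X') + X' * X') / 4)%C; [|field].
  rewrite HA, HB. field.
Qed.

Lemma Ccosh_double (A : C) : (Ccosh (2 * A) = 1 + 2 * (Csinh A * Csinh A))%C.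
Proof.
  unfold Ccosh, Csinh. replace (2 * A)%C with (A + A)%C by ring.
  replace (- (A + A))%C with (- A + - A)%C by ring. rewrite !Cexp_plus.
  pose proof (Cexp_opp A) as HA. set (X := Cexp A) in *. set (X' := Cexp (- A)) in *.
  transitivity ((X * X + X' * X' - 2 * (X * X') + 2) / 2)%C; [rewrite HA|]; field.
Qed.

Lemma Ccos_double (b : C) : (Ccos (2 * b) = 2 * (Ccos b * Ccos b) - 1)%C.
Proof.
  unfold Ccos. replace (Ci * (2 * b))%C with (Ci * b + Ci * b)%C by ring.
  replace (- (Ci * b + Ci * b))%C with (- (Ci * b) + - (Ci * b))%C by ring. rewrite !Cexp_plus.
  pose proof (Cexp_opp (Ci * b)) as HA.
  set (X := Cexp (Ci * b)) in *. set (X' := Cexp (- (Ci * b))) in *.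
  transitivity ((X * X + X' * X' + 2 * (X * X') - 2) / 2)%C; [rewrite HA|]; field.
Qed.

Lemma Cmult_integral (z w : C) : (z * w)%C = 0 -> z = 0 \/ w = 0.
Proof.
  intros H. apply (f_equal Cmod) in H. rewrite Cmod_mult, Cmod_0 in H.
  destruct (Rmult_integral _ _ H) as [E|E]; [left|right]; apply Cmod_eq_0, E.
Qed.

Lemma Im_Ccos (z : C) : Im (Ccos z) = - (sin (Re z) * sinh (Im z)).
Proof.
  unfold Ccos, Cexp, sinh. destruct z as [x y]; simpl.
  replace (0 * x - 1 * y) with (- y) by ring. replace (0 * y + 1 * x) with x by ring.
  rewrite sin_neg, Ropp_involutive. field.
Qed.

Lemma Re_Csinh (z : C) : Re (Csinh z) = sinh (Re z) * cos (Im z).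
Proof.
  unfold Csinh, Cexp, sinh. destruct z as [x y]; simpl. rewrite cos_neg, sin_neg. field.
Qed.

Lemma Im_Csinh (z : C) : Im (Csinh z) = cosh (Re z) * sin (Im z).
Proof.
  unfold Csinh, Cexp, cosh. destruct z as [x y]; simpl. rewrite cos_neg, sin_neg. field.
Qed.

Lemma cosh_sqr (x : R) : cosh x * cosh x = 1 + sinh x * sinh x.
Proof.
  unfold cosh, sinh.
  assert (F : exp x * exp (- x) = 1) by (rewrite <- exp_plus, Rplus_opp_r; apply exp_0).
  nra.
Qed.

(** [sin |x| = cos (PI / 2 - |x|)], and [|y| < PI / 2 - |x|] where the cosine is decreasing. *)
Lemma sin_sqr_lt_cos_sqr (x y : R) : Rabs x + Rabs y < PI / 2 -> sin x * sin x < cos y * cos y.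
Proof.
  intros H. pose proof (Rabs_pos x). pose proof (Rabs_pos y).
  assert (E1 : sin x * sin x = sin (Rabs x) * sin (Rabs x)).
  { unfold Rabs. destruct (Rcase_abs x); [rewrite sin_neg; ring|reflexivity]. }
  assert (E2 : cos y = cos (Rabs y)).
  { unfold Rabs. destruct (Rcase_abs y); [rewrite cos_neg|]; reflexivity. }
  rewrite E1, E2, <- (cos_shift (Rabs x)).
  assert (cos (PI / 2 - Rabs x) < cos (Rabs y)) by (apply cos_decreasing_1; lra).
  assert (0 <= cos (PI / 2 - Rabs x)) by (apply cos_ge_0; lra).
  nra.
Qed.

(** A value [- rho] of the quotient would give [sinh A = +- i mu cos b] with [mu^2 = 1 + rho].
    Squaring the real and imaginary parts of this equation yields two incompatible inequalities
    between [sinh^2 (Re A)] and [sinh^2 (Im b)]. *)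
Lemma ratio_not_negative (A b : C) (rho : R) : Rabs (Im A) + Rabs (Re b) < PI / 2 -> 0 <= rho ->
  (- RtoC rho * (Ccos b * Ccos b) <> Ccos b * Ccos b + Csinh A * Csinh A)%C.
Proof.
  intros Hab Hrho E.
  set (mu := sqrt (1 + rho)).
  assert (Hmu : mu * mu = 1 + rho) by (apply sqrt_sqrt; lra).
  assert (F : ((Csinh A - Ci * RtoC mu * Ccos b) * (Csinh A + Ci * RtoC mu * Ccos b) = 0)%C).
  { transitivity (Csinh A * Csinh A - (Ci * Ci) * (RtoC mu * RtoC mu) * (Ccos b * Ccos b))%C; [ring|].
    rewrite Ci_sqr, <- RtoC_mult, Hmu, RtoC_plus.
    transitivity ((Ccos b * Ccos b + Csinh A * Csinh A) - - RtoC rho * (Ccos b * Ccos b))%C; [ring|].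
    rewrite E. ring. }
  (* [sg] is the undetermined sign; only [sg * sg = 1] enters, since both parts are squared. *)
  assert (G : exists sg, sg * sg = 1 /\ Csinh A = (RtoC (sg * mu) * (Ci * Ccos b))%C).
  { apply Cmult_integral in F. destruct F as [F|F].
    - exists 1. split; [ring|]. rewrite RtoC_mult.
      transitivity (Csinh A - Ci * RtoC mu * Ccos b + Ci * RtoC mu * Ccos b)%C; [ring|].
      rewrite F. ring.
    - exists (-1). split; [ring|]. rewrite RtoC_mult.
      transitivity (Csinh A + Ci * RtoC mu * Ccos b - Ci * RtoC mu * Ccos b)%C; [ring|].
      rewrite F. ring. }
  destruct G as (sg & Hsg & G).
  assert (GR : sinh (Re A) * cos (Im A) = sg * mu * (sin (Re b) * sinh (Im b))).
  { rewrite <- Re_Csinh, G, Re_RtoC_mult, Re_Ci_mult, Im_Ccos. ring. }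
  assert (GI : cosh (Re A) * sin (Im A) = sg * mu * (cos (Re b) * cosh (Im b))).
  { rewrite <- Im_Csinh, G. rewrite <- Re_Ccos. simpl. unfold Re. ring. }
  pose proof (sin_sqr_lt_cos_sqr (Im A) (Re b) Hab) as L1.
  rewrite Rplus_comm in Hab.
  pose proof (sin_sqr_lt_cos_sqr (Re b) (Im A) Hab) as L2.
  pose proof (cosh_sqr (Re A)) as CA. pose proof (cosh_sqr (Im b)) as CB.
  pose proof (Rle_0_sqr (sin (Im A))) as Q1. pose proof (Rle_0_sqr (sin (Re b))) as Q2.
  pose proof (Rle_0_sqr (sinh (Re A))) as Q3. pose proof (Rle_0_sqr (sinh (Im b))) as Q4.
  unfold Rsqr in *.
  set (s1 := sin (Im A) * sin (Im A)) in *. set (c1 := cos (Im A) * cos (Im A)) in *.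
  set (s2 := sin (Re b) * sin (Re b)) in *. set (c2 := cos (Re b) * cos (Re b)) in *.
  set (h1 := sinh (Re A) * sinh (Re A)) in *. set (h2 := sinh (Im b) * sinh (Im b)) in *.
  assert (GR2 : h1 * c1 = (1 + rho) * (s2 * h2)).
  { transitivity ((sinh (Re A) * cos (Im A)) * (sinh (Re A) * cos (Im A))); [unfold h1, c1; ring|].
    rewrite GR, <- Hmu. transitivity ((sg * sg) * ((mu * mu) * (s2 * h2)));
      [unfold s2, h2; ring|rewrite Hsg; ring]. }
  assert (GI2 : (1 + h1) * s1 = (1 + rho) * (c2 * (1 + h2))).
  { rewrite <- CA, <- CB, <- Hmu.
    transitivity ((cosh (Re A) * sin (Im A)) * (cosh (Re A) * sin (Im A))); [unfold s1; ring|].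
    rewrite GI. transitivity ((sg * sg) * ((mu * mu) * (c2 * (cosh (Im b) * cosh (Im b)))));
      [unfold c2; ring|rewrite Hsg; ring]. }
  (* Real parts, with [s2 < c1]. *)
  assert (K1 : h1 <= (1 + rho) * h2).
  { apply Rmult_le_reg_r with c1; [lra|]. rewrite GR2.
    assert (0 <= (1 + rho) * h2) by (apply Rmult_le_pos; lra). nra. }
  (* Imaginary parts, with [s1 < c2]. Together with [K1] this gives [1 + rho < 1]. *)
  assert (K2 : (1 + rho) * (1 + h2) < 1 + h1).
  { apply Rmult_lt_reg_r with c2; [lra|].
    replace ((1 + rho) * (1 + h2) * c2) with ((1 + h1) * s1) by lra.
    apply Rmult_lt_compat_l; lra. }
  lra.
Qed.

(** * Decomposition of the integrand and choice of the branch *)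

(** Uses [sin^2 (a x) = (1 - cos (2 a x)) / 2] and the product formula for
    [cosh (beta x) cos (2 a x)]. The constants subtracted in the kernels cancel because
    [1/2 - 1/4 - 1/4 = 0]. *)
Lemma integrand_split (a beta : C) (x : R) : 0 < x ->
  (1 / 2 * cosh_kernel beta x - 1 / 4 * cosh_kernel (beta + 2 * Ci * a) x
     - 1 / 4 * cosh_kernel (beta - 2 * Ci * a) x
   = Csin (a * x) ^ 2 * (Ccosh (beta * x) / Csinh x) * (1 / x))%C.
Proof.
  intros Hx. pose proof (sinh_pos x Hx) as P.
  assert (x0 : RtoC x <> 0) by (intros E; injection E; lra).
  assert (s0 : RtoC (sinh x) <> 0) by (intros E; injection E; lra).
  unfold cosh_kernel. rewrite Csinh_R, !RtoC_inv by lra.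
  unfold Ccosh, Csin.
  set (A := (Ci * (a * x))%C). set (B := (RtoC x * beta)%C).
  replace (RtoC x * (beta + 2 * Ci * a))%C with (B + (A + A))%C by (unfold A, B; ring).
  replace (RtoC x * (beta - 2 * Ci * a))%C with (B + (- A + - A))%C by (unfold A, B; ring).
  replace (beta * RtoC x)%C with B by (unfold B; ring).
  replace (- (B + (A + A)))%C with (- B + (- A + - A))%C by ring.
  replace (- (B + (- A + - A)))%C with (- B + (A + A))%C by ring.
  rewrite !Cexp_plus.
  pose proof (Cexp_opp A) as HA.
  set (X := Cexp A) in *. set (X' := Cexp (- A)) in *.
  set (Y := Cexp B) in *. set (Y' := Cexp (- B)) in *.
  replace (((X - X') / (2 * Ci)) ^ 2)%C with (- (X * X - 2 * (X * X') + X' * X') / 4)%C.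
  - rewrite HA. field. split; assumption.
  - transitivity ((X - X') * (X - X') / (4 * (Ci * Ci)))%C; [rewrite Ci_sqr; field|field].
    apply Ci_neq_0.
Qed.

(** The shifts by [2ia] and [- 2ia] move the real part by [- 2 Im a] and [2 Im a]; the convergence
    condition keeps both parameters in the strip. *)
Lemma Rabs_Re_shift (a beta : C) : 2 * Rabs (Im a) + Rabs (Re beta) < 1 ->
  Rabs (Re (beta + 2 * Ci * a)) < 1 /\ Rabs (Re (beta - 2 * Ci * a)) < 1.
Proof.
  replace (Re (beta + 2 * Ci * a)) with (Re beta - 2 * Im a) by (simpl; unfold Re, Im; ring).
  replace (Re (beta - 2 * Ci * a)) with (Re beta + 2 * Im a) by (simpl; unfold Re, Im; ring).
  unfold Rabs. repeat destruct Rcase_abs; lra.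
Qed.
(* Four times the value of the integral for the parameters [t a] and [t beta]. *)
Definition exponent (a beta : C) (t : R) : C :=
  (2 * log_sec (RtoC t * beta) - log_sec (RtoC t * (beta + 2 * Ci * a))
    - log_sec (RtoC t * (beta - 2 * Ci * a)))%C.

(** [Cexp_log_sec] at the three parameters turns the exponential into the two shifted cosines
    divided by [cos^2 b], and [Ccos_mul_Ccos] evaluates their product. *)
Lemma Cexp_exponent (a beta : C) (t : R) :
  2 * Rabs (Im a) + Rabs (Re beta) < 1 -> 0 <= t <= 1 ->
  let b := (RtoC (PI / 2) * (RtoC t * beta))%C in
  let A := (RtoC PI * (RtoC t * a))%C in
  (Cexp (exponent a beta t) * (Ccos b * Ccos b) = Ccos b * Ccos b + Csinh A * Csinh A)%C.
Proof.
  intros hconv Ht b A.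
  assert (h0 : Rabs (Re beta) < 1) by (pose proof (Rabs_pos (Im a)); lra).
  destruct (Rabs_Re_shift a beta hconv) as [h1 h2].
  pose proof (Cexp_log_sec _ (Rabs_Re_scale t _ Ht h0)) as E0.
  pose proof (Cexp_log_sec _ (Rabs_Re_scale t _ Ht h1)) as E1.
  pose proof (Cexp_log_sec _ (Rabs_Re_scale t _ Ht h2)) as E2.
  rewrite <- Ccos_mul_Ccos.
  assert (P2 : RtoC PI = (2 * RtoC (PI / 2))%C) by (rewrite <- RtoC_mult; f_equal; field).
  replace (b + Ci * A)%C with (RtoC (PI / 2) * (RtoC t * (beta + 2 * Ci * a)))%C
    by (unfold b, A; rewrite P2; ring).
  replace (b - Ci * A)%C with (RtoC (PI / 2) * (RtoC t * (beta - 2 * Ci * a)))%C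
    by (unfold b, A; rewrite P2; ring).
  fold b in E0. unfold exponent.
  set (g0 := log_sec (RtoC t * beta)) in *.
  set (g1 := log_sec (RtoC t * (beta + 2 * Ci * a))) in *.
  set (g2 := log_sec (RtoC t * (beta - 2 * Ci * a))) in *.
  replace (2 * g0 - g1 - g2)%C with (g0 + g0 + (- g1 + - g2))%C by ring.
  rewrite !Cexp_plus.
  pose proof (Cexp_opp g1) as F1. pose proof (Cexp_opp g2) as F2.
  set (c0 := Ccos b) in *.
  set (c1 := Ccos (RtoC (PI / 2) * (RtoC t * (beta + 2 * Ci * a)))) in *.
  set (c2 := Ccos (RtoC (PI / 2) * (RtoC t * (beta - 2 * Ci * a)))) in *.
  set (x0 := Cexp g0) in *. set (x1 := Cexp g1) in *. set (x2 := Cexp g2) in *.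
  set (y1 := Cexp (- g1)) in *. set (y2 := Cexp (- g2)) in *.
  transitivity ((x0 * c0) * (x0 * c0) * (y1 * y2))%C; [ring|]. rewrite E0.
  transitivity ((x1 * c1) * (x2 * c2) * (y1 * y2))%C; [rewrite E1, E2; ring|].
  transitivity ((x1 * y1) * (x2 * y2) * (c1 * c2))%C; [ring|rewrite F1, F2; ring].
Qed.

Lemma exponent_continuous (a beta : C) (t : R) :
  2 * Rabs (Im a) + Rabs (Re beta) < 1 -> 0 <= t <= 1 ->
  continuity_pt (fun t => Im (exponent a beta t)) t.
Proof.
  intros hconv Ht.
  assert (h0 : Rabs (Re beta) < 1) by (pose proof (Rabs_pos (Im a)); lra).
  destruct (Rabs_Re_shift a beta hconv) as [h1 h2].
  assert (D : exists l, Cder (exponent a beta) t l).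
  { eexists. apply Cder_minus; [apply Cder_minus|].
    - apply Cder_mult; [apply Cder_const|apply Cder_log_sec; assumption].
    - apply Cder_log_sec; assumption.
    - apply Cder_log_sec; assumption. }
  destruct D as [l Hl]. apply continuity_pt_filterlim.
  exact (proj2 (Cder_continuous _ _ _ Hl)).
Qed.

(** An imaginary part [PI] or [- PI] would make the exponential a negative real number, which
    [ratio_not_negative] excludes. *)
Lemma exponent_Im_neq_PI (a beta : C) (t : R) :
  2 * Rabs (Im a) + Rabs (Re beta) < 1 -> 0 <= t <= 1 ->
  Im (exponent a beta t) <> PI /\ Im (exponent a beta t) <> - PI.
Proof.
  intros hconv Ht.
  assert (K : Cexp (exponent a beta t) <> (- RtoC (exp (Re (exponent a beta t))))%C).
  { intros E. pose proof (Cexp_exponent a beta t hconv Ht) as H. cbv zeta in H.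
    rewrite E in H. revert H. apply ratio_not_negative; [|left; apply exp_pos].
    rewrite !Re_RtoC_mult. pose proof PI_RGT_0.
    replace (Im (RtoC PI * (RtoC t * a))) with (PI * (t * Im a)) by (simpl; unfold Im; ring).
    rewrite !Rabs_mult, (Rabs_pos_eq PI), (Rabs_pos_eq t), (Rabs_pos_eq (PI / 2)) by lra.
    pose proof (Rabs_pos (Im a)). pose proof (Rabs_pos (Re beta)).
    (* Multiplied by [PI / 2] this is the bound that [ratio_not_negative] asks for. *)
    assert (t * (2 * Rabs (Im a) + Rabs (Re beta)) < 1) by nra. nra. }
  split; intros E; apply K; unfold Cexp; rewrite E; apply C_ext; simpl;
    rewrite ?cos_neg, ?sin_neg, ?cos_PI, ?sin_PI; ring.
Qed.

Lemma exponent_Im_bounds (a beta : C) : 2 * Rabs (Im a) + Rabs (Re beta) < 1 ->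
  - PI < Im (exponent a beta 1) < PI.
Proof.
  intros hconv. pose proof PI_RGT_0.
  set (f := fun t => Im (exponent a beta t)).
  assert (f0 : f 0 = 0).
  { unfold f, exponent. rewrite !Cmult_0_l, log_sec_0. simpl. ring. }
  assert (Cf : forall t, 0 <= t <= 1 -> continuity_pt f t)
    by (intros; apply exponent_continuous; assumption).
  split; apply Rnot_le_lt; intros Hle.
  (* The intermediate value theorem is applied between a smaller value at 0 and a larger one at 1,
     hence to [- f] for the lower bound. *)
  - destruct (f_interv_is_interv (fun t => - f t) 0 1 PI) as (t & Ht & E).
    + lra.
    + rewrite f0. unfold f. lra.
    + intros t Ht. apply continuity_pt_opp, Cf, Ht.
    + destruct (exponent_Im_neq_PI a beta t hconv Ht) as [_ N]. apply N.
      change (f t = - PI). lra.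
  - destruct (f_interv_is_interv f 0 1 PI) as (t & Ht & E).
    + lra.
    + rewrite f0. unfold f. lra.
    + exact Cf.
    + destruct (exponent_Im_neq_PI a beta t hconv Ht) as [N _]. apply N. exact E.
Qed.

Theorem mainTheorem8 (a beta : C)
    (hconv : 2 * Rabs (Im a) + Rabs (Re beta) < 1) :
  is_RInt_gen (V := C_R_NormedModule)
    (fun x : R =>
       (Csin (a * x) ^ 2 * (Ccosh (beta * x) / Csinh x) * (1 / x))%C)
    (at_right 0) (Rbar_locally p_infty)
    (1 / 4 * Cln ((Ccosh (2 * a * PI) + Ccos (beta * PI))
                    / (1 + Ccos (beta * PI))))%C.
Proof.
  assert (h0 : Rabs (Re beta) < 1) by (pose proof (Rabs_pos (Im a)); lra).
  destruct (Rabs_Re_shift a beta hconv) as [h1 h2].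
  apply CInt_is_RInt_gen.
  (* Double-angle formulas turn the quotient into [(c^2 + S^2) / c^2], the case [t = 1] of
     [Cexp_exponent]. *)
  assert (R : ((Ccosh (2 * a * PI) + Ccos (beta * PI)) / (1 + Ccos (beta * PI)))%C
              = Cexp (exponent a beta 1)).
  { pose proof (Cexp_exponent a beta 1 hconv ltac:(lra)) as H. cbv zeta in H.
    rewrite !Cmult_1_l in H.
    pose proof (Ccos_half_pi_neq_0 beta h0) as N.
    assert (P2 : RtoC PI = (2 * RtoC (PI / 2))%C) by (rewrite <- RtoC_mult; f_equal; field).
    replace (2 * a * RtoC PI)%C with (2 * (RtoC PI * a))%C by ring.
    replace (beta * RtoC PI)%C with (2 * (RtoC (PI / 2) * beta))%C by (rewrite P2; ring).
    rewrite Ccosh_double, Ccos_double.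
    set (c := Ccos _) in *. set (S := Csinh _) in *.
    replace (1 + (2 * (c * c) - 1))%C with (2 * (c * c))%C by ring.
    replace (1 + 2 * (S * S) + (2 * (c * c) - 1))%C with (2 * (c * c + S * S))%C by ring.
    rewrite <- H. field. exact N. }
  rewrite R, Cln_Cexp by (apply exponent_Im_bounds; exact hconv).
  unfold exponent. rewrite !Cmult_1_l.
  eapply CInt_ext; [intros x Hx; apply integrand_split; exact Hx|].
  replace (1 / 4 * (2 * log_sec beta - log_sec (beta + 2 * Ci * a) - log_sec (beta - 2 * Ci * a)))%C
    with (1 / 2 * log_sec beta - 1 / 4 * log_sec (beta + 2 * Ci * a)
           - 1 / 4 * log_sec (beta - 2 * Ci * a))%C by field.
  apply CInt_minus; [apply CInt_minus|]; apply CInt_scal, CInt_cosh_kernel; assumption.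
Qed.
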